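(* The right-hand side $F(R,q)=\big(K_R-f(p(q))R-\alpha(q)R,\ \alpha(q)R-\mu(q)\big)$ of the system $$\dot R=K_R-f(p(q))R-\alpha(q)R,\qquad\dot q=\alpha(q)R-\mu(q)$$ is continuously differentiable at the fixed points $x^s=(R^s,q^s)$ and $x^u=(R^u,q^u)$. In every point $x=(R,q)$ of differentiability of $F$ the Jacobian is $$DF(x)=\begin{bmatrix}-(f(p(q))+\alpha(q)) & -R\big((f\circ p)'(q)+\alpha'(q)\big)\\ \alpha(q) & R\alpha'(q)-\mu'(q)\end{bmatrix}.$$ The divergence of the vector field in its points of differentiability is $$\operatorname{div}F(R,q)=\begin{cases}-f(p(q))-\alpha(q)+\alpha'(q)R-\frac{\mu^*}{q_c}, & 0<q<q_c,\\ -f(p(q))-\alpha(q)+\alpha'(q)R, & q_c<q.\end{cases}$$ In particular: (i) the fixed point $(R^s,q^s)$ is locally asymptotically stable; (ii) the fixed point $(R^u,q^u)$ is unstable, with a linearization having one positive and one negative eigenvalue; (iii) the system does not have nontrivial periodic solutions in the interior of $\mathbb{R}_{\ge0}^2$.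
   Context: Write $\mathbb{R}_+=\mathbb{R}_{\ge0}=[0,\infty)$. Fix constants $K_R,\mu^*,q_c,\beta,q_m,q_{\max}>0$ with $K_R>\mu^*$ and $q_{\max}\ge2q_m$. The system is considered on $\mathbb{R}_+^2$. Price function $p:\mathbb{R}_+\to\mathbb{R}_+$: $p(q)=\beta q$ for $0\le q\le q_m$, $p(q)=\beta(2q_m-q)$ for $q_m\le q\le2q_m$, $p(q)=0$ for $q>2q_m$. Service rate $\mu:\mathbb{R}_+\to\mathbb{R}_+$: $\mu(q)=\frac{\mu^*}{q_c}q$ for $0\le q\le q_c$, $\mu(q)=\mu^*$ for $q\ge q_c$. Sensitivity function $f:\mathbb{R}_+\to\mathbb{R}_+$: continuously differentiable with strictly positive derivative. Set $\eta_1(q)=\frac{\mu(q)}{\alpha(q)}$ (for $q\in[0,q_{\max})$) and $\eta_2(q)=\frac{K_R}{\alpha(q)+f(p(q))}$. Admission rate $\alpha:\mathbb{R}_+\to[0,\infty)$: continuously differentiable and such that (i) $\alpha$ is positive and strictly decreasing on $[0,q_{\max})$; (ii) $\alpha(q)=0$ for $q\ge q_{\max}$; (iii) there are exactly two points $q^s,q^u$ in $(0,q_{\max})$ solving $\eta_1(q)=\eta_2(q)$; moreover $q^s\in(0,q_m)$, $q^u\in(q_m,2q_m)$, $\eta_1'(q^u)<\eta_2'(q^u)$, and $\mu(q^s)=\mu(q^u)=\mu^*$. Put $R^s=\eta_1(q^s)$ and $R^u=\eta_1(q^u)$; then $(R^s,q^s)$ and $(R^u,q^u)$ are the fixed points of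 the system. Primes denote derivatives with respect to $q$; $(f\circ p)'$ is the derivative of $q\mapsto f(p(q))$.
   Formalization: Continuous differentiability of F at x^s is claimed only when q^s ≠ q_c, since for q^s = q_c the service rate μ has a kink at q^s and F is not differentiable at x^s; all other claims are unrestricted. *)

(* Defs.v *)
From HB Require Import structures.
From mathcomp Require Import all_boot all_order all_algebra.
From mathcomp Require Import all_classical all_reals all_analysis.

Set Implicit Arguments.
Unset Strict Implicit.
Unset Printing Implicit Defensive.

Import Order.TTheory GRing.Theory Num.Theory.
Import numFieldNormedType.Exports.

Local Open Scope ring_scope.
Local Open Scope classical_set_scope.

Definition vec2 (R : realType) (a b : R) : 'rV[R]_2 :=
  \row_(j < 2) (if j == 0 then a else b).

Definition mat2 (R : realType) (a b c d : R) : 'M[R]_2 :=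
  \matrix_(i < 2, j < 2)
    (if i == 0 then (if j == 0 then a else b) else (if j == 0 then c else d)).

Definition quadrant (R : realType) : set 'rV[R]_2 :=
  [set x | 0 <= x 0 0 /\ 0 <= x 0 1].

Definition open_quadrant (R : realType) : set 'rV[R]_2 :=
  [set x | 0 < x 0 0 /\ 0 < x 0 1].

(** A C^1 function on [0, +oo[ is represented by an extension to R that is also
    differentiable from the left at 0 (e.g. the extension by its tangent line),
    so that [derive1 h] is the one-sided derivative at 0.  Values on negative
    reals are otherwise unconstrained. *)
Definition C1_nonneg (R : realType) (h : R -> R) : Prop :=
  (forall t, 0 <= t -> derivable h t 1) /\
  {within `[0, +oo[, continuous (derive1 h)}.

(** Only used on [0, +oo[; the first affine pieces are prolonged to q < 0. *)
Definition price (R : realType) (beta qm q : R) : R :=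
  if q <= qm then beta * q
  else if q <= 2 * qm then beta * (2 * qm - q) else 0.

Definition service (R : realType) (mustar qc q : R) : R :=
  if q <= qc then mustar / qc * q else mustar.

Definition vfield (R : realType) (K : R) (f p alpha mu : R -> R)
    (x : 'rV[R]_2) : 'rV[R]_2 :=
  vec2 (K - f (p (x 0 1)) * x 0 0 - alpha (x 0 1) * x 0 0)
       (alpha (x 0 1) * x 0 0 - mu (x 0 1)).

(** MathComp-Analysis' [jacobian] acts on row vectors from the right. *)
Definition DF (R : realType) (F : 'rV[R]_2 -> 'rV[R]_2) (x : 'rV[R]_2) :
    'M[R]_2 := (jacobian F x)^T.

Definition divergence (R : realType) (F : 'rV[R]_2 -> 'rV[R]_2)
    (x : 'rV[R]_2) : R :=
  \sum_(i < 2) 'D_(delta_mx 0 i) (fun y => F y 0 i) x.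

Definition C1_at (R : realType) (F : 'rV[R]_2 -> 'rV[R]_2) (x : 'rV[R]_2) :
    Prop :=
  (\forall y \near x, differentiable F y) /\ {for x, continuous (DF F)}.

(** Solutions on [0, T[ of x' = F x with values in the closed quadrant.
    Where F is continuous, right-continuity at 0 yields the equation at t = 0
    for the one-sided derivative. *)
Definition forward_solution (R : realType) (F : 'rV[R]_2 -> 'rV[R]_2)
    (T : \bar R) (x : R -> 'rV[R]_2) : Prop :=
  [/\ x t @[t --> 0^'+] --> x 0,
      forall t, 0 < t -> (t%:E < T)%E -> is_derive t 1 x (F (x t)) &
      forall t, 0 <= t -> (t%:E < T)%E -> quadrant (x t)].

Definition fixed_point (R : realType) (F : 'rV[R]_2 -> 'rV[R]_2)
    (xstar : 'rV[R]_2) : Prop := quadrant xstar /\ F xstar = 0.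

Definition lyapunov_stable (R : realType) (F : 'rV[R]_2 -> 'rV[R]_2)
    (xstar : 'rV[R]_2) : Prop :=
  forall e : R, 0 < e -> exists2 d : R, 0 < d &
    forall (T : \bar R) (x : R -> 'rV[R]_2), (0 < T)%E ->
      forward_solution F T x -> `|x 0 - xstar| < d ->
      forall t, 0 <= t -> (t%:E < T)%E -> `|x t - xstar| < e.

(** Existence of global forward solutions is part of the definition, so that
    attraction cannot hold vacuously. *)
Definition locally_attractive (R : realType) (F : 'rV[R]_2 -> 'rV[R]_2)
    (xstar : 'rV[R]_2) : Prop :=
  exists2 d : R, 0 < d &
    forall y, quadrant y -> `|y - xstar| < d ->
      (exists2 x, forward_solution F +oo%E x & x 0 = y) /\
      (forall x, forward_solution F +oo%E x -> x 0 = y ->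
         x t @[t --> +oo] --> xstar).

Definition locally_asymptotically_stable (R : realType)
    (F : 'rV[R]_2 -> 'rV[R]_2) (xstar : 'rV[R]_2) : Prop :=
  [/\ fixed_point F xstar, lyapunov_stable F xstar
    & locally_attractive F xstar].

Definition unstable (R : realType) (F : 'rV[R]_2 -> 'rV[R]_2)
    (xstar : 'rV[R]_2) : Prop :=
  fixed_point F xstar /\ ~ lyapunov_stable F xstar.

Definition nontrivial_periodic_solution (R : realType)
    (F : 'rV[R]_2 -> 'rV[R]_2) (x : R -> 'rV[R]_2) : Prop :=
  [/\ forall t : R, is_derive t 1 x (F (x t)),
      exists2 T : R, 0 < T & forall t, x (t + T) = x t &
      exists t s : R, x t != x s].

(* Main.v *)
Require Import Defs.
From HB Require Import structures.
From mathcomp Require Import all_boot all_order all_algebra.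
From mathcomp Require Import all_classical all_reals all_analysis.
From mathcomp Require Import ring lra.
Set Implicit Arguments.
Unset Strict Implicit.
Unset Printing Implicit Defensive.
Import Order.TTheory GRing.Theory Num.Theory.
Import numFieldNormedType.Exports.
Local Open Scope ring_scope.
Local Open Scope classical_set_scope.

(** Near a fixed point [(R, q)] one can write, with [a = f(p q) + alpha q],
    [b = R ((f o p)' + alpha')], [c = alpha q], [d = - R alpha' >= 0],
    [F = (- a x - b y, c x - (d + j) y) + o(|(x, y)|)], where [j] is the
    difference quotient of the service rate, which lies between [0] and
    [mustar / qc] because [mu] may have its kink at the fixed point.  At [qs] one
    has [a d + b c > 0], and one quadratic form decreases along all these linear
    fields at once, so it is a strict Lyapunov function even if [qs = qc].  At
    [qu] the condition [eta1' < eta2'] says [a d + b c < 0], and an indefinite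
    quadratic form grows along trajectories.  Attraction and instability need
    solutions to exist, which is Picard iteration.

    The system is a damped oscillator in [q]: with [v = q'], the energy
    [v^2 / (2 alpha(q)) - int (K - (f(p q) + alpha(q)) mu(q) / alpha(q)) dq] has
    derivative at most [- v^2] along solutions, which excludes periodic ones. *)

(** * Real analysis *)

(** At [qs = qc] the field has no linearization, since the one-sided slopes of the service rate
    differ. The bounded chord slope [j] takes the place of the derivative, and one form valid for
    all [j] takes the place of eigenvalues. At [qu] this cannot happen, as [mu qs = mustar] forces
    [qc <= qs < qu]. The quantity [a d + b c = R (alpha (f o p)' - f(p) alpha')] gets its sign at
    [qs] from the rising price, and at [qu] from differentiating [eta1] and [eta2]. Solutions have
    to stay in the closed quadrant and [F] is controlled only locally. Both are handled in a small
    ball around a fixed point with positive coordinates: the field truncated outside the ball has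
    global solutions. The energy needs neither Green's formula nor the topology of closed curves.
    The price enters it only under the integral, so the kinks of [p] are harmless; only the kink of
    the service rate is felt. Division by [alpha] is allowed because [q] has no maximum where
    [alpha = 0]. *)

Lemma real_induction (R : realType) (P : R -> Prop) (a b : R) :
  P a ->
  (forall t, a < t -> t <= b -> (forall s, a <= s -> s < t -> P s) -> P t) ->
  (forall t, a <= t -> t < b -> (forall s, a <= s -> s <= t -> P s) ->
    exists2 h, 0 < h & forall s, t < s -> s < t + h -> P s) ->
  forall t, a <= t -> t <= b -> P t.
Proof.
move=> Pa Plim Popen t0 at0 t0b.
have ab := le_trans at0 t0b.
(* [A] collects the endpoints of initial segments on which [P] holds. The limit hypothesis puts
   [sup A] into [A], and the openness hypothesis would produce a larger element if [sup A < b]. *)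
pose A : set R := [set t | a <= t <= b /\ forall s, a <= s -> s <= t -> P s].
have Aa : A a.
  split; first by rewrite lexx ab.
  by move=> s as_ sa; rewrite (_ : s = a)//; apply/eqP; rewrite eq_le as_ sa.
have ubA : ubound A b by move=> t [/andP[]].
have supA : has_sup A by split; [exists a|exists b].
have aS : a <= sup A by apply: ub_le_sup => //; exists b.
have Sb : sup A <= b by apply: ge_sup => //; exists a.
have PltS s : a <= s -> s < sup A -> P s.
  move=> as_ sS; have [|t At st] := @sup_adherent _ A (sup A - s) _ supA.
    by rewrite subr_gt0.
  by move: st; rewrite subKr => /ltW st; case: At => _; apply.
have PS : P (sup A).
  move: aS; rewrite le_eqVlt => /predU1P[<-//|aS]; exact: Plim.
have PleS s : a <= s -> s <= sup A -> P s.
  by move=> as_; rewrite le_eqVlt => /predU1P[->//|]; exact: PltS.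
suff Seqb : sup A = b by apply: PleS => //; rewrite Seqb.
apply/eqP; rewrite eq_le Sb leNgt/=; apply/negP => Sltb.
have [h h0 Ph] := Popen _ aS Sltb PleS.
pose t := Num.min b (sup A + h / 2).
have St : sup A < t by rewrite lt_min Sltb/= ltrDl divr_gt0.
have tb : t <= b by rewrite ge_min lexx.
have tSh : t < sup A + h.
  by rewrite gt_min ltrD2l gtr_pMr// invf_lt1 ?ltr1n// orbT.
suff At : A t by have := ub_le_sup (ex_intro _ b ubA) At; rewrite leNgt St.
split; first by rewrite tb (le_trans aS (ltW St)).
move=> s as_ st; have [sS|Ss] := leP s (sup A); first exact: PleS.
by apply: Ph => //; exact: le_lt_trans tSh.
Qed.

Lemma derivable_is_derive1 (R : realType) (V : normedModType R) (g : R -> V)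
    (t : R) :
  derivable g t 1 -> is_derive t 1 g (derive1 g t).
Proof. by move=> dg; rewrite derive1E; exact: derivableP. Qed.

Lemma continuous_primitive (R : realType) (g : R -> R) (a : R) :
  continuous g ->
  exists G : R -> R, forall t, a < t -> is_derive t 1 G (g t).
Proof.
move=> cg; exists (fun x => \int[lebesgue_measure]_(t in `[a, x]) g t)%R.
move=> t at_.
have [||d e] := @continuous_FTC1_closed R g a t (t + 1) _ _ at_ (cg t).
- by rewrite ltrDl.
- apply: continuous_compact_integrable; first exact: segment_compact.
  exact: continuous_subspaceT.
by rewrite -e; exact: derivable_is_derive1.
Qed.

Lemma is_derive_continuous (R : realType) (V : normedModType R) (u : R -> V)
    (t : R) (d : V) :
  is_derive t 1 u d -> {for t, continuous u}.
Proof.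
by move=> [du _]; apply: differentiable_continuous; exact/derivable1_diffP.
Qed.

Lemma continuous_within_closed (R : realType) (u : R -> R) (a b : R) :
  u t @[t --> a^'+] --> u a -> (forall t, a < t -> t <= b -> {for t, continuous u}) ->
  {within `[a, b], continuous u}.
Proof.
move=> ua uc; have [ab|ba|<-] := ltgtP a b; last first.
- by rewrite set_itv1; exact: continuous_subspace1.
- by rewrite set_itv_ge ?bnd_simp -?ltNge//; exact: continuous_subspace0.
apply/continuous_within_itvP => //; split => //.
  by move=> t; rewrite in_itv/= => /andP[at_ tb]; apply: uc => //; exact: ltW.
exact/cvg_at_left_filter/(uc b ab (lexx b)).
Qed.

(** Only right-continuity is asked at [a], because a forward solution comes with no derivative at
    time 0. *)
Lemma nonincreasing_deriv (R : realType) (u du : R -> R) (a b : R) :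
  u t @[t --> a^'+] --> u a ->
  (forall t, a < t -> t <= b -> is_derive t 1 u (du t)) ->
  (forall t, a < t -> t <= b -> du t <= 0) ->
  forall t, a <= t -> t <= b -> u t <= u a.
Proof.
move=> ua hu du0 t at_ tb.
have cu : {within `[a, t], continuous u}.
  apply: continuous_within_closed => // s as_ st.
  exact/is_derive_continuous/(hu s as_ (le_trans st tb)).
have hs s : s \in `]a, t[%R -> a < s /\ s <= b.
  by rewrite in_itv/= => /andP[? st]; split => //; exact: le_trans (ltW st) tb.
apply: (ler0_derive1_le_cc _ _ cu); rewrite ?in_itv/= ?lexx ?at_//.
  by move=> s /hs[s1 s2]; case: (hu s s1 s2).
by move=> s /hs[s1 s2]; rewrite derive1E; case: (hu s s1 s2) => _ ->; exact: du0.
Qed.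

Lemma geometric_cauchy_limit (R : realType) (V : completeNormedModType R)
    (u : nat -> V) (B : R) :
  (forall n, `|u n.+1 - u n| <= B / 2 ^+ n) ->
  exists l, forall n, `|l - u n| <= 2 * B / 2 ^+ n.
Proof.
move=> hu.
have B0 : 0 <= B by have := hu 0%N; rewrite expr0 divr1; exact/le_trans/normr_ge0.
(* The bound is the exact sum of the increments from [n] to [n + m]; the weaker [2 * B / 2 ^+ n]
   would not pass through the induction. *)
have dist n m : `|u (n + m)%N - u n| <= 2 * B / 2 ^+ n - 2 * B / 2 ^+ (n + m).
  elim: m => [|m ih]; first by rewrite addn0 !subrr normr0.
  rewrite addnS (le_trans (ler_distD (u (n + m)%N) _ _))//.
  apply: le_trans (lerD (hu _) ih) _.
  rewrite exprS invfM (_ : 2 * B * (2^-1 / 2 ^+ (n + m)) = B / 2 ^+ (n + m)).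
    by rewrite mulrAC -!mulrA; lra.
  by field; rewrite expf_neq0.
have distW n m : (n <= m)%N -> `|u m - u n| <= 2 * B / 2 ^+ n.
  move=> nm; have := dist n (m - n)%N; rewrite subnKC// => /le_trans; apply.
  by rewrite gerBl divr_ge0 ?mulr_ge0 ?exprn_ge0.
have cu : cvgn u.
  apply/cauchy_cvgP/cauchy_exP => e e0.
  have e'0 : 0 < e / (2 * B + 1) by rewrite divr_gt0// ltr_wpDl// mulr_ge0.
  have [N _ hN] := near_infty_natSinv_expn_lt (PosNum e'0).
  exists (u N); exists N => // m /= Nm.
  rewrite -ball_normE /= distrC (le_lt_trans (distW _ _ Nm))//.
  have := hN N (leqnn N); rewrite /= ltr_pdivlMr ?ltr_wpDl ?mulr_ge0//.
  apply: le_lt_trans; rewrite mul1r mulrC ler_wpM2l ?invr_ge0 ?exprn_ge0//.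
  by rewrite lerDl.
exists (limn u) => n; apply/ler_addgt0Pr => e e0.
have [m _ hm] := (cvgrPdist_lt _ _).1 cu _ e0.
rewrite (le_trans (ler_distD (u (maxn m n)) _ _))// addrC.
apply: lerD; first by apply: distW; exact: leq_maxr.
by apply/ltW/hm; exact: leq_maxl.
Qed.

Lemma mx_entry_le (R : realType) (m n : nat) (M : 'M[R]_(m, n)) i j :
  `|M i j| <= `|M|.
Proof.
rewrite [leRHS]/Num.Def.normr/= mx_normrE.
exact: (le_bigmax _ (fun ij : 'I_m * 'I_n => `|M ij.1 ij.2|) (i, j)).
Qed.

Lemma mx_norm_le (R : realType) (m n : nat) (M : 'M[R]_(m, n)) (e : R) :
  0 <= e -> (forall i j, `|M i j| <= e) -> `|M| <= e.
Proof.
move=> e0 h; rewrite [leLHS]/Num.Def.normr/= mx_normrE.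
by apply: bigmax_le => // ij _; exact: h.
Qed.

Lemma geometric_cauchy_limit_mx (R : realType) (m n : nat)
    (u : nat -> 'M[R]_(m, n)) (B : R) :
  0 <= B -> (forall k, `|u k.+1 - u k| <= B / 2 ^+ k) ->
  exists l, forall k, `|l - u k| <= 2 * B / 2 ^+ k.
Proof.
move=> B0 hu.
have /choice[l hl] (ij : 'I_m * 'I_n) : exists l : R, forall k,
    `|l - u k ij.1 ij.2| <= 2 * B / 2 ^+ k.
  apply: (@geometric_cauchy_limit R R (fun k => u k ij.1 ij.2)) => k.
  have := mx_entry_le (u k.+1 - u k) ij.1 ij.2; rewrite !mxE => /le_trans; exact.
exists (\matrix_(i, j) l (i, j)) => k.
apply: mx_norm_le => [|i j]; first by rewrite divr_ge0 ?mulr_ge0 ?exprn_ge0.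
by rewrite !mxE; exact: (hl (i, j)).
Qed.

Lemma is_derive_mxP (R : realType) (V : normedModType R) (m n : nat)
    (M : V -> 'M[R]_(m, n)) (t v : V) (d : 'M[R]_(m, n)) :
  is_derive t v M d <->
  forall i j, is_derive t v (fun x => M x i j) (d i j).
Proof.
split=> [[dM <-] i j|h].
  by apply: DeriveDef; [exact: (derivable_mxP _ _ _).1|rewrite derive_mx// mxE].
have dM : derivable M t v by apply/derivable_mxP => i j; case: (h i j).
apply: DeriveDef => //; rewrite derive_mx//; apply/matrixP => i j; rewrite mxE.
by case: (h i j).
Qed.

(** Both [u - w] and [- u - w] are nonincreasing. In the Picard estimates this comparison stands in
    for bounding the norm of an integral by the integral of the norm. *)
Lemma norm_le_deriv (R : realType) (u du w dw : R -> R) :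
  u t @[t --> 0^'+] --> u 0 -> w t @[t --> 0^'+] --> w 0 ->
  (forall t : R, 0 < t -> is_derive t 1 u (du t)) ->
  (forall t : R, 0 < t -> is_derive t 1 w (dw t)) ->
  `|u 0| <= w 0 -> (forall t : R, 0 < t -> `|du t| <= dw t) ->
  forall t : R, 0 <= t -> `|u t| <= w t.
Proof.
move=> cu cw hu hw u0 duw t t0.
rewrite ler_norml; have := u0; rewrite ler_norml => /andP[u0l u0r].
have h1 := @nonincreasing_deriv R (fun t => u t - w t) (fun t => du t - dw t) 0 t.
have h2 := @nonincreasing_deriv R (fun t => - u t - w t) (fun t => - du t - dw t) 0 t.
apply/andP; split.
  have : - u t - w t <= - u 0 - w 0.
    apply: h2; rewrite ?lexx//.
    - by apply: cvgB => //; exact: cvgN.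
    - move=> s s0 _; apply: is_deriveB; [apply: is_deriveN|]; [exact: hu|exact: hw].
    - move=> s s0 _; have := duw s s0; rewrite ler_norml => /andP[]; lra.
  by lra.
have : u t - w t <= u 0 - w 0.
  apply: h1; rewrite ?lexx//.
  - exact: cvgB.
  - move=> s s0 _; apply: is_deriveB; [exact: hu|exact: hw].
  - move=> s s0 _; have := duw s s0; rewrite ler_norml => /andP[]; lra.
by lra.
Qed.

Lemma cvg_mx (R : realType) (T : Type) (F : set_system T) (m n : nat)
    (M : T -> 'M[R]_(m, n)) (l : 'M[R]_(m, n)) : Filter F ->
  (forall i j, M x i j @[x --> F] --> l i j) -> M x @[x --> F] --> l.
Proof.
move=> FF h; apply/cvgrPdist_le => e e0.
have : \forall x \near F, forall ij : 'I_m * 'I_n, `|l ij.1 ij.2 - M x ij.1 ij.2| <= e.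
  by apply: filter_forall => -[i j]; exact: (cvgrPdist_le _ _).1 (h i j) _ e0.
apply: filterS => x hx; apply: mx_norm_le; first exact: ltW.
by move=> i j; rewrite !mxE; exact: (hx (i, j)).
Qed.

Lemma lipschitz_continuous (R : realType) (V W : normedModType R)
    (g : V -> W) (L : R) :
  0 < L -> (forall x y, `|g x - g y| <= L * `|x - y|) -> continuous g.
Proof.
move=> L0 h x; apply/cvgrPdist_lt => e e0.
near=> y; rewrite (le_lt_trans (h _ _))// -ltr_pdivlMl//.
near: y; apply: cvgr_dist_lt; rewrite ?mulr_gt0 ?invr_gt0//.
Unshelve. all: by end_near. Qed.

Lemma max_lipschitz (R : realType) (c a b : R) :
  `|Num.max a c - Num.max b c| <= `|a - b|.
Proof.
wlog ab : a b / a <= b.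
  by move=> h; case: (leP a b) => [|/ltW] /h//; rewrite distrC [leRHS]distrC.
rewrite distrC ger0_norm; last by rewrite subr_ge0 ge_max !le_max ab lexx orbT.
rewrite distrC ger0_norm ?subr_ge0//.
by have [ac|ca] := leP a c; have [bc|cb] := leP b c; lra.
Qed.

Lemma vector_primitive (R : realType) (n : nat) (g : R -> 'rV[R]_n)
    (y0 : 'rV[R]_n) :
  continuous g ->
  exists y : R -> 'rV[R]_n, [/\ continuous y, forall t : R, t <= 0 -> y t = y0 &
    forall t : R, 0 < t -> is_derive t 1 y (g t)].
Proof.
move=> cg.
(* The primitives start at -1, so they are differentiable, hence continuous, at 0 too; [Num.max t 0]
   then freezes the curve at [y0] for negative times. *)
have /choice[P hP] (i : 'I_n) : exists P : R -> R,
    forall t : R, -1 < t -> is_derive t 1 P (g t 0 i).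
  apply: (@continuous_primitive R (fun t => g t 0 i)) => t.
  exact: (continuous_comp (cg t) (@coord_continuous _ _ _ _ _ _)).
exists (fun t => y0 + \row_i (P i (Num.max t 0) - P i 0)); split.
- move=> t; apply: cvg_mx => i j; rewrite !mxE.
  under eq_fun do rewrite !mxE.
  apply: cvgD; first exact: cvg_cst.
  apply: cvgB; last exact: cvg_cst.
  have cmax : continuous (fun s : R => Num.max s 0).
    apply: (@lipschitz_continuous _ _ _ _ 1) => // a b.
    by rewrite mul1r; exact: max_lipschitz.
  have : {for t, continuous (P j \o (fun s : R => Num.max s 0))}.
    apply: continuous_comp; first exact: cmax.
    apply: (@is_derive_continuous _ _ (P j) _ _ (hP j _ _)).
    by rewrite lt_max; apply/orP; right; lra.
  exact.
- move=> t t0; rewrite max_r//; apply/rowP => i; rewrite !mxE subrr addr0//.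
- move=> t t0; apply/is_derive_mxP => i j; rewrite ord1.
  apply: (@near_eq_is_derive _ _ _ (fun s => (y0 0 j - P j 0) + P j s)).
    near=> s; rewrite !mxE max_l; first by rewrite addrCA addrC -addrA.
    by apply/ltW; near: s; exact: lt_nbhsr.
  rewrite -[g t 0 j]add0r; apply: is_deriveD; apply: hP; lra.
Unshelve. all: by end_near. Qed.

(** * Existence of solutions *)

Lemma is_derive_expRM (R : realType) (c k t : R) :
  is_derive t 1 (fun s => c * expR (k * s)) (c * (k * expR (k * t))).
Proof.
have h1 : is_derive t 1 (fun s : R => k * s) k.
  by rewrite -[X in is_derive _ _ _ X]mulr1; apply: (@is_deriveZ _ _ _ id).
have h2 := is_derive1_comp (is_derive_expR (k * t)) h1.
rewrite mulrC [k * _]mulrC -mulrC; exact: (@is_deriveZ _ _ _ (fun s : R => expR (k * s))).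
Qed.

(** A global Lipschitz bound gives a solution for all positive times. The curve is constant for
    negative times and continuous on all of [R], which yields the right-continuity at 0 of forward
    solutions. *)
Theorem picard (R : realType) (n : nat) (G : 'rV[R]_n -> 'rV[R]_n) (L : R)
    (y0 : 'rV[R]_n) :
  0 < L -> (forall x y, `|G x - G y| <= L * `|x - y|) ->
  exists x : R -> 'rV[R]_n, [/\ continuous x, x 0 = y0 &
    forall t : R, 0 < t -> is_derive t 1 x (G (x t))].
Proof.
move=> L0 GL.
have cG : continuous G := lipschitz_continuous L0 GL.
(* [S] is the integral operator on continuous curves; on other curves nothing is known about its
   value. *)
have /choice[S hS] (x : R -> 'rV[R]_n) : exists y : R -> 'rV[R]_n, continuous x ->
    [/\ continuous y, forall t : R, t <= 0 -> y t = y0 &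
      forall t : R, 0 < t -> is_derive t 1 y (G (x t))].
  have [cx|ncx] := pselect (continuous x); last by exists x.
  have [|y hy] := @vector_primitive R n (fun t => G (x t)) y0; last by exists y.
  by move=> t; apply: (continuous_comp (cx t)); exact: cG.
(* In the weighted sup norm [sup |x t| / E t] the integral operator contracts by 1/2. *)
pose E (t : R) := expR (2 * L * t).
have E0 t : 0 < E t by exact: expR_gt0.
have rc (y : R -> 'rV[R]_n) j : continuous y ->
    y t 0 j @[t --> 0^'+] --> y 0 0 j.
  move=> cy; apply: cvg_at_right_filter.
  exact: (continuous_comp (cy 0) (@coord_continuous _ _ _ _ _ _)).
have rcE c : c * E t @[t --> 0^'+] --> c * E 0.
  apply: cvg_at_right_filter.
  exact: (is_derive_continuous (is_derive_expRM c (2 * L) 0)).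
have contraction (x z : R -> 'rV[R]_n) M : continuous x -> continuous z ->
    (forall t : R, 0 <= t -> `|x t - z t| <= M * E t) ->
    forall t : R, 0 <= t -> `|S x t - S z t| <= M / 2 * E t.
  move=> cx cz hM t t0.
  have [cSx Sx0 dSx] := hS x cx; have [cSz Sz0 dSz] := hS z cz.
  have M0 : 0 <= M.
    have := hM 0 (lexx _); rewrite /E mulr0 expR0 mulr1; exact/le_trans.
  have ME s : 0 <= M / 2 * E s by rewrite mulr_ge0 ?divr_ge0// ltW.
  apply: mx_norm_le => // i j; rewrite ord1 !mxE.
  (* [M / 2 * E] has derivative [L * M * E], which is the Lipschitz bound on the difference of the
     derivatives. *)
  apply: (@norm_le_deriv R (fun t => S x t 0 j - S z t 0 j)
    (fun t => G (x t) 0 j - G (z t) 0 j) (fun s => M / 2 * E s)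
    (fun s => M / 2 * (2 * L * E s))) => //.
  - by apply: cvgB; exact: rc.
  - move=> s s0; apply: is_deriveB; first exact: (is_derive_mxP _ _ _ _).1 (dSx s s0) 0 j.
    exact: (is_derive_mxP _ _ _ _).1 (dSz s s0) 0 j.
  - by move=> s s0; exact: is_derive_expRM.
  - by rewrite Sx0// Sz0// subrr normr0.
  - move=> s s0.
    have := mx_entry_le (G (x s) - G (z s)) 0 j; rewrite !mxE => /le_trans; apply.
    apply: (le_trans (GL _ _)); have := hM s (ltW s0); rewrite -(ler_pM2l L0).
    by move/le_trans; apply; rewrite le_eqVlt; apply/orP; left; apply/eqP; field.
pose x_ k := iter k S (cst y0).
have cx_ k : continuous (x_ k).
  by elim: k => [|k ih]; [exact: cst_continuous|case: (hS _ ih)].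
have x_0 k t : t <= 0 -> x_ k t = y0.
  by case: k => [//|k] t0; case: (hS _ (cx_ k)) => _ h _; exact: h.
(* Chosen so that [C * E], whose derivative is [|G y0|] times [E], dominates the first increment,
   which has velocity [G y0]. *)
pose C := `|G y0| / (2 * L).
have E0' t : 0 <= E t by exact: expR_ge0.
have C0 : 0 <= C by rewrite divr_ge0// mulr_ge0// ltW.
have x_dist k (t : R) : 0 <= t -> `|x_ k.+1 t - x_ k t| <= C / 2 ^+ k * E t.
  elim: k t => [|k ih] t t0; last first.
    rewrite exprSr invfM mulrA.
    exact: (contraction _ _ _ (cx_ k.+1) (cx_ k) ih).
  have [cS S0 dS] := hS _ (cx_ 0%N).
  apply: mx_norm_le => [|i j]; first by rewrite expr0 divr1; apply: mulr_ge0 => //; exact: ltW.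
  rewrite ord1 !mxE expr0 divr1.
  apply: (@norm_le_deriv R (fun t => S (x_ 0%N) t 0 j - y0 0 j)
    (fun t => G y0 0 j) (fun s => C * E s)
    (fun s => C * (2 * L * E s))) => //.
  - by apply: cvgB; [exact: rc|exact: cvg_cst].
  - move=> s s0; rewrite -[X in is_derive _ _ _ X]subr0; apply: is_deriveB.
    exact: (is_derive_mxP _ _ _ _).1 (dS s s0) 0 j.
  - by move=> s s0; exact: is_derive_expRM.
  - by rewrite S0// subrr normr0 mulr_ge0// ltW.
  - move=> s s0; rewrite (le_trans (mx_entry_le _ _ _))//.
    rewrite /C mulrA divfK ?mulf_neq0 ?gt_eqF//.
    rewrite ler_peMr// -expR0 ler_expR !mulr_ge0// ltW//.
have x_distT k (t : R) : `|x_ k.+1 t - x_ k t| <= (C * E t) / 2 ^+ k.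
  have [t0|/ltW t0] := leP 0 t; first by rewrite mulrAC x_dist.
  by rewrite !x_0// subrr normr0 divr_ge0// mulr_ge0.
have /choice[X hX] (t : R) : exists l, forall k, `|l - x_ k t| <= 2 * (C * E t) / 2 ^+ k.
  by apply: (@geometric_cauchy_limit_mx R 1 n (fun k => x_ k t)) => //; rewrite mulr_ge0.
have geo (B e : R) : 0 <= B -> 0 < e -> exists k, B / 2 ^+ k < e.
  move=> B0 e0; have e'0 : 0 < e / (B + 1) by rewrite divr_gt0// ltr_wpDl.
  have [N _ hN] := near_infty_natSinv_expn_lt (PosNum e'0).
  exists N; have := hN N (leqnn N); rewrite /= ltr_pdivlMr ?ltr_wpDl//.
  apply: le_lt_trans; rewrite mul1r mulrC ler_wpM2l ?invr_ge0 ?exprn_ge0//.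
  by rewrite lerDl.
have cE : continuous E.
  move=> t; have -> : E = (fun s => 1 * expR (2 * L * s)).
    by apply/funext => s; rewrite mul1r.
  exact: (is_derive_continuous (is_derive_expRM 1 (2 * L) t)).
(* A three-epsilon argument: [E s < E t + 1] near [t], so one index [k] controls the tail at all
   these [s]. *)
have cX : continuous X.
  move=> t; apply/cvgrPdist_lt => e e0.
  pose B := 2 * (C * (E t + 1)).
  have B0 : 0 <= B by apply: mulr_ge0 => //; apply: mulr_ge0 => //; exact: addr_ge0.
  have e3 : 0 < e / 3 by rewrite divr_gt0.
  have [k hk] := geo _ _ B0 e3.
  have tail s : E s < E t + 1 -> `|X s - x_ k s| < e / 3.
    move=> Es; apply: le_lt_trans hk; apply: (le_trans (hX s k)).
    by rewrite ler_pM2r ?invr_gt0 ?exprn_gt0// ler_pM2l// ler_wpM2l// ltW.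
  near=> s.
  have h1 : `|X t - x_ k t| < e / 3 by apply: tail; rewrite ltrDl.
  have h2 : `|X s - x_ k s| < e / 3.
    apply: tail; near: s; apply: (cvgr_lt (E t)); [exact: cE|by rewrite ltrDl].
  have h3 : `|x_ k t - x_ k s| < e / 3.
    by near: s; apply: cvgr_dist_lt => //; exact: cx_.
  have -> : X t - X s = (X t - x_ k t) + (x_ k t - x_ k s) - (X s - x_ k s).
    by rewrite opprB !subrKA.
  rewrite (le_lt_trans (ler_normB _ _))//.
  have := ler_normD (X t - x_ k t) (x_ k t - x_ k s); lra.
have [cY Y0 dY] := hS X cX.
have B0 t : 0 <= 2 * (C * E t) by do 2!apply: mulr_ge0 => //.
(* The iterate [x_ k.+1 = S (x_ k)] is close to [S X] by contraction and to [X] by the tail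
   bound. *)
have YX : S X = X.
  apply/funext => t; have [t0|t0] := leP t 0.
    rewrite Y0//; apply/esym/eqP; rewrite -subr_eq0 -normr_eq0 eq_le normr_ge0 andbT.
    apply/ler_addgt0Pl => e e0; rewrite addr0.
    have [k hk] := geo _ _ (B0 t) e0.
    by rewrite -(x_0 k t t0); exact/(le_trans (hX t k))/ltW.
  apply/eqP; rewrite -subr_eq0 -normr_eq0 eq_le normr_ge0 andbT.
  apply/ler_addgt0Pl => e e0; rewrite addr0.
  have [k hk] := geo _ _ (B0 t) e0.
  apply: le_trans (ltW hk); rewrite (le_trans (ler_distD (x_ k.+1 t) _ _))//.
  have h1 : `|S X t - x_ k.+1 t| <= (2 * C / 2 ^+ k) / 2 * E t.
    apply: contraction => //; last exact: ltW.
    by move=> s s0; apply: (le_trans (hX s k)); rewrite !mulrA mulrAC.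
  have h2 := hX t k.+1; rewrite distrC in h2.
  apply: le_trans (lerD h1 h2) _; rewrite exprS invfM.
  by rewrite le_eqVlt; apply/orP; left; apply/eqP; field; rewrite expf_neq0.
exists X; split => //; first by rewrite -YX Y0.
by move=> t t0; rewrite -{1}YX; exact: dY.
Unshelve. all: by end_near. Qed.

(** Both points range over the ball, as Picard iteration requires; a bound on [g x - g x0] alone
    would not suffice. *)
Definition lipschitz_at (R : realType) (V W : normedModType R) (g : V -> W)
    (x0 : V) : Prop :=
  exists L r : R, [/\ 0 < L, 0 < r & forall x y, `|x - x0| < r ->
    `|y - x0| < r -> `|g x - g y| <= L * `|x - y|].

Lemma lipschitz_at_cst (R : realType) (V W : normedModType R) (k : W) (x0 : V) :
  lipschitz_at (fun=> k) x0.
Proof. by exists 1, 1; split => // x y _ _; rewrite subrr normr0 mul1r. Qed.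

Lemma lipschitz_atB (R : realType) (V W : normedModType R) (g h : V -> W)
    (x0 : V) :
  lipschitz_at g x0 -> lipschitz_at h x0 -> lipschitz_at (fun x => g x - h x) x0.
Proof.
move=> [L [r [L0 r0 gL]]] [L' [r' [L'0 r'0 hL]]].
exists (L + L'), (Num.min r r'); split; [exact: addr_gt0|by rewrite lt_min r0|].
move=> x y; rewrite !lt_min => /andP[xr xr'] /andP[yr yr'].
have -> : g x - h x - (g y - h y) = (g x - g y) - (h x - h y).
  by rewrite !opprB addrACA [RHS]addrACA [- h x + _]addrC.
by rewrite (le_trans (ler_normB _ _))// mulrDl lerD ?gL ?hL.
Qed.

Lemma lipschitz_atM (R : realType) (V : normedModType R) (g h : V -> R)
    (x0 : V) :
  lipschitz_at g x0 -> lipschitz_at h x0 -> lipschitz_at (fun x => g x * h x) x0.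
Proof.
move=> [L [r [L0 r0 gL]]] [L' [r' [L'0 r'0 hL]]].
pose A := `|g x0| + L * r; pose B := `|h x0| + L' * r'.
have A0 : 0 < A by rewrite ltr_wpDl// mulr_gt0.
have B0 : 0 < B by rewrite ltr_wpDl// mulr_gt0.
exists (A * L' + B * L), (Num.min r r'); split.
- by rewrite addr_gt0// mulr_gt0.
- by rewrite lt_min r0.
move=> x y; rewrite !lt_min => /andP[xr xr'] /andP[yr yr'].
have gA : `|g x| <= A.
  rewrite -(subrK (g x0) (g x)) (le_trans (ler_normD _ _))// addrC lerD2l.
  rewrite (le_trans (gL _ _ xr _)) ?subrr ?normr0//.
  by rewrite ler_pM2l// ltW.
have hB : `|h y| <= B.
  rewrite -(subrK (h x0) (h y)) (le_trans (ler_normD _ _))// addrC lerD2l.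
  rewrite (le_trans (hL _ _ yr' _)) ?subrr ?normr0//.
  by rewrite ler_pM2l// ltW.
have -> : g x * h x - g y * h y = g x * (h x - h y) + h y * (g x - g y) by ring.
rewrite (le_trans (ler_normD _ _))// !normrM mulrDl -!mulrA.
by apply: lerD; apply: ler_pM => //; [exact: hL|exact: gL].
Qed.

Lemma lipschitz_at_comp (R : realType) (U V W : normedModType R) (g : U -> V)
    (h : V -> W) (x0 : U) :
  lipschitz_at g x0 -> lipschitz_at h (g x0) -> lipschitz_at (fun x => h (g x)) x0.
Proof.
move=> [L [r [L0 r0 gL]]] [L' [r' [L'0 r'0 hL]]].
exists (L' * L), (Num.min r (r' / L)); split; first exact: mulr_gt0.
  by rewrite lt_min r0 divr_gt0.
move=> x y; rewrite !lt_min => /andP[xr xr'] /andP[yr yr'].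
have near_g z : `|z - x0| < r -> `|z - x0| < r' / L -> `|g z - g x0| < r'.
  move=> zr; rewrite ltr_pdivlMr// mulrC; apply: le_lt_trans.
  by apply: gL; rewrite ?subrr ?normr0.
rewrite (le_trans (hL _ _ (near_g _ xr xr') (near_g _ yr yr')))//.
by rewrite -mulrA ler_pM2l// gL.
Qed.

Lemma lipschitz_at_coord (R : realType) (m n : nat) (i : 'I_m) (j : 'I_n)
    (x0 : 'M[R]_(m, n)) :
  lipschitz_at (fun x : 'M[R]_(m, n) => x i j) x0.
Proof.
exists 1, 1; split => // x y _ _; rewrite mul1r.
by have := mx_entry_le (x - y) i j; rewrite !mxE.
Qed.

Lemma lipschitz_at_vec2 (R : realType) (V : normedModType R) (g h : V -> R)
    (x0 : V) :
  lipschitz_at g x0 -> lipschitz_at h x0 -> lipschitz_at (fun x => vec2 (g x) (h x)) x0.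
Proof.
move=> [L [r [L0 r0 gL]]] [L' [r' [L'0 r'0 hL]]].
exists (L + L'), (Num.min r r'); split; [exact: addr_gt0|by rewrite lt_min r0|].
move=> x y; rewrite !lt_min => /andP[xr xr'] /andP[yr yr'].
apply: mx_norm_le => [|i j]; first by rewrite mulr_ge0// ltW// addr_gt0.
rewrite !mxE mulrDl; case: ifP => _.
  by rewrite -[leLHS]addr0 lerD ?gL// mulr_ge0// ltW.
by rewrite -[leLHS]add0r lerD ?hL// mulr_ge0// ltW.
Qed.

(** Mean value inequality on a ball where the derivative is below its modulus at [x0] plus 1;
    continuity of the derivative at the single point [x0] provides this ball. *)
Lemma lipschitz_at_C1 (R : realType) (g : R -> R) (x0 : R) :
  (\forall x \near x0, derivable g x 1) -> derive1 g x @[x --> x0] --> derive1 g x0 ->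
  lipschitz_at g x0.
Proof.
move=> dg cdg.
have bdg : \forall x \near x0, `|derive1 g x| < `|derive1 g x0| + 1.
  have cn : `|derive1 g x| @[x --> x0] --> `|derive1 g x0| by exact: cvg_norm.
  by apply: (cvgr_lt _ cn); rewrite ltrDl.
have : \forall x \near x0, derivable g x 1 /\ `|derive1 g x| < `|derive1 g x0| + 1.
  by near=> x; split; near: x.
move=> /nbhs_normP[r /= r0 hr].
have hr' z : `|z - x0| < r -> derivable g z 1 /\ `|derive1 g z| < `|derive1 g x0| + 1.
  by move=> zr; apply: hr; rewrite /= distrC.
exists (`|derive1 g x0| + 1), r; split => //.
move=> x y; wlog xy : x y / x <= y.
  move=> h xr yr; case: (leP x y) => [|/ltW] xy; first exact: h.
  by rewrite distrC [X in _ * X]distrC h.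
move=> xr yr.
have btw z : x <= z -> z <= y -> `|z - x0| < r.
  by move: xr yr; rewrite !ltr_norml => /andP[? ?] /andP[? ?] ? ?; apply/andP; split; lra.
have [||c + e] := @MVT_segment R g (derive1 g) x y xy.
- move=> z; rewrite in_itv/= => /andP[xz zy].
  have [dz _] := hr' z (btw z (ltW xz) (ltW zy)).
  exact: derivable_is_derive1.
- apply: derivable_within_continuous => z; rewrite in_itv/= => /andP[xz zy].
  by have [] := hr' z (btw z xz zy).
rewrite in_itv/= => /andP[xc cy].
rewrite distrC e normrM [X in _ <= _ * X]distrC ler_wpM2r//.
by have [_ /ltW] := hr' c (btw c xc cy).
Unshelve. all: by end_near. Qed.

Lemma min_lipschitz (R : realType) (c a b : R) :
  `|Num.min a c - Num.min b c| <= `|a - b|.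
Proof.
have := max_lipschitz (- c) (- a) (- b); rewrite -!oppr_min !opprK ![- _ + _]addrC.
by rewrite distrC [X in _ <= X]distrC.
Qed.

(** [F] is composed with the coordinatewise projection onto the cube of radius [r] around [c], which
    is the closed ball of the maximum norm. The projection is 1-Lipschitz, so [picard] applies. The
    curve follows [F] only while it stays in the ball, and each use has to show that it does. *)
Lemma picard_local (R : realType) (n : nat) (F : 'rV[R]_n -> 'rV[R]_n)
    (c y0 : 'rV[R]_n) (L r : R) :
  0 < L -> 0 < r ->
  (forall x y, `|x - c| <= r -> `|y - c| <= r -> `|F x - F y| <= L * `|x - y|) ->
  exists x : R -> 'rV[R]_n, [/\ continuous x, x 0 = y0 &
    forall t : R, 0 < t -> `|x t - c| <= r -> is_derive t 1 x (F (x t))].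
Proof.
move=> L0 r0 FL.
pose clamp (x : 'rV[R]_n) : 'rV[R]_n :=
  \row_j Num.min (Num.max (x 0 j) (c 0 j - r)) (c 0 j + r).
have clamp_ball x : `|clamp x - c| <= r.
  apply: mx_norm_le => [|i j]; first exact: ltW.
  rewrite ord1 !mxE ler_norml; apply/andP; split.
    by rewrite lerBrDr le_min le_max; apply/andP; split; [apply/orP; right|]; lra.
  by rewrite lerBlDr ge_min; apply/orP; right; lra.
have clamp_id x : `|x - c| <= r -> clamp x = x.
  move=> xr; apply/rowP => j; rewrite mxE.
  have := mx_entry_le (x - c) 0 j; rewrite !mxE => /le_trans/(_ xr).
  by rewrite ler_norml => /andP[h1 h2]; rewrite max_l ?min_l//; lra.
have clamp_lip x y : `|clamp x - clamp y| <= `|x - y|.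
  apply: mx_norm_le => [//|i j]; rewrite ord1 !mxE.
  rewrite (le_trans (min_lipschitz _ _ _))// (le_trans (max_lipschitz _ _ _))//.
  by have := mx_entry_le (x - y) 0 j; rewrite !mxE.
have [|x [cx x0 dx]] := @picard R n (F \o clamp) L y0 L0.
  by move=> x y /=; rewrite (le_trans (FL _ _ _ _))// ler_pM2l.
exists x; split => // t t0 xtr; have := dx t t0; by rewrite /= clamp_id.
Qed.

(** * Quadratic Lyapunov functions *)

Definition qform (R : realType) (p s w : R) (z : 'rV[R]_2) : R :=
  p * z 0 0 ^+ 2 + 2 * s * (z 0 0 * z 0 1) + w * z 0 1 ^+ 2.

(** Twice the product [z P v] for the symmetric matrix [P] with entries [p, s, s, w]: the derivative
    of [qform] at [z] in the direction [v]. *)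
Definition qform_dot (R : realType) (p s w : R) (z v : 'rV[R]_2) : R :=
  2 * ((p * z 0 0 + s * z 0 1) * v 0 0 + (s * z 0 0 + w * z 0 1) * v 0 1).

Lemma is_derive_qform (R : realType) (p s w : R) (x : R -> 'rV[R]_2)
    (c v : 'rV[R]_2) (t : R) :
  is_derive t 1 x v ->
  is_derive t 1 (fun u => qform p s w (x u - c)) (qform_dot p s w (x t - c) v).
Proof.
move=> /is_derive_mxP dx.
have dc j : is_derive t 1 (fun u => x u 0 j - c 0 j) (v 0 j).
  by rewrite -[v 0 j]subr0; apply: is_deriveB; exact: dx.
have -> : (fun u => qform p s w (x u - c)) =
    (fun u => p * ((x u 0 0 - c 0 0) * (x u 0 0 - c 0 0)) +
      2 * s * ((x u 0 0 - c 0 0) * (x u 0 1 - c 0 1)) +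
      w * ((x u 0 1 - c 0 1) * (x u 0 1 - c 0 1))).
  by apply/funext => u; rewrite /qform !mxE !expr2.
apply: is_derive_eq.
rewrite /qform_dot !mxE /= /GRing.scale /=; ring.
Qed.

Lemma qform_continuous (R : realType) (p s w : R) (c : 'rV[R]_2) :
  continuous (fun x : 'rV[R]_2 => qform p s w (x - c)).
Proof.
move=> x; have cc j : (y : 'rV[R]_2) 0 j - c 0 j @[y --> x] --> x 0 j - c 0 j.
  have h : (y : 'rV[R]_2) 0 j @[y --> x] --> x 0 j by exact: coord_continuous.
  by apply: (cvgB h); exact: cvg_cst.
have -> : (fun y : 'rV[R]_2 => qform p s w (y - c)) =
    (fun y : 'rV[R]_2 => p * ((y 0 0 - c 0 0) * (y 0 0 - c 0 0)) +
      2 * s * ((y 0 0 - c 0 0) * (y 0 1 - c 0 1)) +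
      w * ((y 0 1 - c 0 1) * (y 0 1 - c 0 1))).
  by apply/funext => u; rewrite /qform !mxE !expr2.
have cm i j := @cvgM _ _ _ (nbhs_filter x) _ _ _ _ (cc i) (cc j).
have := cvgD (cvgD (cvgM (cvg_cst p) (cm 0 0)) (cvgM (cvg_cst (2 * s)) (cm 0 1)))
  (cvgM (cvg_cst w) (cm 1 1)).
exact.
Qed.

Lemma qform_le (R : realType) (p s w : R) (z : 'rV[R]_2) :
  qform p s w z <= (`|p| + 2 * `|s| + `|w|) * `|z| ^+ 2.
Proof.
have zz (i j : 'I_2) : `|z 0 i * z 0 j| <= `|z| ^+ 2.
  by rewrite normrM expr2 ler_pM// mx_entry_le.
have le1 (a : R) i j : a * (z 0 i * z 0 j) <= `|a| * `|z| ^+ 2.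
  by rewrite (le_trans (ler_norm _))// normrM ler_wpM2l.
have := le1 p 0 0; have := le1 (2 * s) 0 1; have := le1 w 1 1.
rewrite normrM (ger0_norm (ler0n R 2)) /qform; lra.
Qed.

(** Turns coercivity for the Euclidean square, as completing squares produces it, into coercivity
    for the maximum norm. *)
Lemma norm_rV2_sqr (R : realType) (z : 'rV[R]_2) :
  `|z| ^+ 2 <= z 0 0 ^+ 2 + z 0 1 ^+ 2.
Proof.
have [->|z0] := eqVneq `|z| 0; first by rewrite expr0n /= addr_ge0 ?sqr_ge0.
have [[i j] /= e] := mx_norm_neq0 z0.
have -> : `|z| = `|z i j| by [].
rewrite ord1 real_normK ?num_real//.
case: j {e} => -[|[|//]] hj.
  by rewrite (_ : Ordinal hj = 0) ?lerDl ?sqr_ge0//; exact/val_inj.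
by rewrite (_ : Ordinal hj = 1) ?lerDr ?sqr_ge0//; exact/val_inj.
Qed.

Lemma cvg_le_near (R : realType) (u : R -> R) (t e : R) :
  0 < t -> {for t, continuous u} -> (forall s, 0 <= s -> s < t -> u s < e) ->
  u t <= e.
Proof.
move=> t0 cu h; rewrite leNgt; apply/negP => et.
have : \forall s \near t^'-, e < u s.
  by apply: (cvgr_gt (u t)) => //; exact: cvg_at_left_filter.
move=> hn; near (t^'-) => s.
have st : s < t by near: s; exact: nbhs_left_lt.
have s0 : 0 <= s by near: s; apply: nbhs_left_ge.
have := h s s0 st; rewrite ltNge => /negP; apply; apply: ltW.
by near: s.
Unshelve. all: by end_near. Qed.

Lemma right_continuous_lt (R : realType) (u : R -> R) (t e : R) :
  u s @[s --> t^'+] --> u t -> u t < e ->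
  exists2 h, 0 < h & forall s, t < s -> s < t + h -> u s < e.
Proof.
move=> cu ute; have : \forall s \near t^'+, u s < e by exact: cvgr_lt cu _ ute.
move=> [h /= h0 hu]; exists h => // s ts sth.
by apply: hu => //=; rewrite ltr0_norm ?subr_lt0//; lra.
Qed.

(** The form does not increase while the curve is near [c], and its sublevel set through the start
    lies in the ball of radius [e]. The equation is assumed only within [r] of [c], so both forward
    solutions and the curves of [picard_local] are covered. *)
Lemma lyapunov_trap (R : realType) (F : 'rV[R]_2 -> 'rV[R]_2) (c : 'rV[R]_2)
    (p s w m r e : R) :
  0 < m -> 0 < e -> e < r ->
  (forall z, m * `|z| ^+ 2 <= qform p s w z) ->
  (forall x, `|x - c| < r -> qform_dot p s w (x - c) (F x) <= 0) ->
  exists2 d, 0 < d & forall (T : \bar R) (x : R -> 'rV[R]_2),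
    x t @[t --> 0^'+] --> x 0 ->
    (forall t, 0 < t -> (t%:E < T)%E -> {for t, continuous x}) ->
    (forall t, 0 < t -> (t%:E < T)%E -> `|x t - c| < r ->
      is_derive t 1 x (F (x t))) ->
    `|x 0 - c| < d ->
    forall t, 0 <= t -> (t%:E < T)%E -> `|x t - c| < e.
Proof.
move=> m0 e0 er Qm Qdot.
pose M := `|p| + 2 * `|s| + `|w| + 1.
have M0 : 0 < M by rewrite ltr_wpDl// !addr_ge0// mulr_ge0.
have QM z : qform p s w z <= M * `|z| ^+ 2.
  by rewrite (le_trans (qform_le _ _ _ _))// ler_wpM2r ?sqr_ge0// lerDl.
(* Both bounds on [h] enter [M * h ^+ 2 <= m]: a start within [e * h] of [c] has form value below
   [m * e ^+ 2]. *)
pose h := Num.min 1 (m / M).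
have h0 : 0 < h by rewrite lt_min ltr01 divr_gt0.
have h1 : h <= 1 by rewrite ge_min lexx.
have hm : M * h ^+ 2 <= m.
  have hM : h * M <= m by rewrite -ler_pdivlMr// ge_min lexx orbT.
  by have := mulr_ge0 (ltW h0) (ltW M0); nra.
exists (e * h); first exact: mulr_gt0.
move=> T x cx0 cx dx x0 t t0 tT.
have cQ u : x v @[v --> u^'+] --> x u ->
    qform p s w (x v - c) @[v --> u^'+] --> qform p s w (x u - c).
  move=> cu; apply: (@continuous_cvg _ _ _ _ _ x (fun y => qform p s w (y - c))) cu.
  exact: qform_continuous.
have cN u : x v @[v --> u^'+] --> x u -> `|x v - c| @[v --> u^'+] --> `|x u - c|.
  by move=> cu; apply: cvg_norm; apply: (cvgB cu); exact: cvg_cst.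
have lt_T u : u <= t -> (u%:E < T)%E by move=> ut; rewrite (le_lt_trans _ tT)// lee_fin.
have crx u : 0 <= u -> u <= t -> x v @[v --> u^'+] --> x u.
  rewrite le_eqVlt => /predU1P[<-//|u0] ut.
  by apply: cvg_at_right_filter; exact: (cx u u0 (lt_T u ut)).
apply: (@real_induction R (fun t => `|x t - c| < e) 0 t) => //.
- by rewrite (lt_le_trans x0)// ger_pMr.
- move=> u u0 ut hu.
  have cu := cx u u0 (lt_T u ut).
  (* Passing to the limit only gives [<= e]. As [e < r], the equation still holds at [u], and
     monotonicity of the form restores the strict inequality. *)
  have xu : `|x u - c| <= e.
    apply: (@cvg_le_near R (fun v => `|x v - c|) u e u0) => //.
    by apply: cvg_norm; apply: (cvgB cu); exact: cvg_cst.
  have hr v : 0 < v -> v <= u -> `|x v - c| < r.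
    move=> v0; rewrite le_eqVlt => /predU1P[->|vu]; first exact: le_lt_trans er.
    by rewrite (lt_trans _ er)// hu// ltW.
  have Qu : qform p s w (x u - c) <= qform p s w (x 0 - c).
    apply: (@nonincreasing_deriv R (fun v => qform p s w (x v - c))
      (fun v => qform_dot p s w (x v - c) (F (x v))) 0 u) => //; last 3 first.
    - move=> v v0 vu; apply: is_derive_qform; apply: dx => //; last exact: hr.
      by apply: lt_T; exact: le_trans ut.
    - by move=> v v0 vu; apply: Qdot; exact: hr.
    - exact: ltW.
    exact: cQ.
  have : m * `|x u - c| ^+ 2 < m * e ^+ 2.
    apply: (le_lt_trans (Qm _)); apply: (le_lt_trans Qu).
    apply: (le_lt_trans (QM _)).
    apply: (@lt_le_trans _ _ (M * (e * h) ^+ 2)).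
      by rewrite ltr_pM2l// ltrXn2r ?nnegrE// mulr_ge0// ltW.
    by rewrite exprMn mulrCA mulrC ler_wpM2r ?sqr_ge0.
  by rewrite ltr_pM2l// ltr_pXn2r ?nnegrE// ltW.
- move=> u u0 ut hu; apply: right_continuous_lt; last exact: hu.
  by apply: cN; apply: crx => //; exact: ltW.
Qed.

(** With [M] bounding the form from above, its derivative is at most [- k / M] times its value, so
    its product with [expR (l * t)], [l = k / M], is nonincreasing. The crude bound
    [1 + l t <= expR (l * t)] is then enough for convergence. *)
Lemma lyapunov_decay (R : realType) (F : 'rV[R]_2 -> 'rV[R]_2) (c : 'rV[R]_2)
    (p s w m k r : R) (x : R -> 'rV[R]_2) :
  0 < m -> 0 < k ->
  (forall z, m * `|z| ^+ 2 <= qform p s w z) ->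
  (forall x, `|x - c| < r -> qform_dot p s w (x - c) (F x) <= - k * `|x - c| ^+ 2) ->
  x t @[t --> 0^'+] --> x 0 ->
  (forall t : R, 0 < t -> is_derive t 1 x (F (x t))) ->
  (forall t : R, 0 <= t -> `|x t - c| < r) ->
  x t @[t --> +oo] --> c.
Proof.
move=> m0 k0 Qm Qdot cx0 dx xr.
pose M := `|p| + 2 * `|s| + `|w| + 1.
have M0 : 0 < M by rewrite ltr_wpDl// !addr_ge0// mulr_ge0.
have QM z : qform p s w z <= M * `|z| ^+ 2.
  by rewrite (le_trans (qform_le _ _ _ _))// ler_wpM2r ?sqr_ge0// lerDl.
pose V u := qform p s w (x u - c).
pose l := k / M.
have l0 : 0 < l by rewrite divr_gt0.
have V0 u : 0 <= V u by rewrite (le_trans _ (Qm _))// mulr_ge0 ?sqr_ge0// ltW.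
have decay t : 0 <= t -> V t * expR (l * t) <= V 0.
  move=> t0.
  have cQ0 : V u @[u --> 0^'+] --> V 0.
    apply: (@continuous_cvg _ _ _ _ _ x (fun y => qform p s w (y - c))) cx0.
    exact: qform_continuous.
  have cE0 : 1 * expR (l * u) @[u --> 0^'+] --> 1 * expR (l * 0).
    exact/cvg_at_right_filter/(is_derive_continuous (is_derive_expRM 1 l 0)).
  have := @nonincreasing_deriv R (fun u => V u * (1 * expR (l * u)))
    (fun u => V u * (1 * (l * expR (l * u))) +
      (1 * expR (l * u)) * qform_dot p s w (x u - c) (F (x u))) 0 t
      (cvgM cQ0 cE0) _ _ t t0 (lexx t).
  rewrite mulr0 expR0 !mul1r mulr1; apply => u u0 ut.
    have dV := is_derive_qform p s w c (dx u u0).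
    exact: (is_deriveM dV (is_derive_expRM 1 l u)).
  rewrite [leLHS](_ : _ = expR (l * u) *
    (l * V u + qform_dot p s w (x u - c) (F (x u)))); last by ring.
  rewrite pmulr_rle0 ?expR_gt0//.
  have h1 := Qdot (x u) (xr u (ltW u0)).
  have h2 : l * V u <= k * `|x u - c| ^+ 2.
    by rewrite /l mulrAC ler_pdivrMr// -mulrA ler_pM2l// mulrC; exact: QM.
  move: h1 h2; rewrite mulNr; lra.
apply/cvgrPdist_lt => e e0.
have me0 : 0 < m * e ^+ 2 by rewrite mulr_gt0// exprn_gt0.
have lme0 : 0 < l * (m * e ^+ 2) by rewrite mulr_gt0.
near=> t; rewrite distrC.
have t0 : 0 < t by near: t; apply: nbhs_pinfty_gt; exact: num_real.
have te : V 0 < t * (l * (m * e ^+ 2)).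
  rewrite -ltr_pdivrMr//; near: t; apply: nbhs_pinfty_gt; exact: num_real.
have h1 : m * `|x t - c| ^+ 2 * expR (l * t) <= V 0.
  by apply: le_trans (decay t (ltW t0)); rewrite ler_pM2r ?expR_gt0.
have h2 : t * (l * (m * e ^+ 2)) < m * e ^+ 2 * expR (l * t).
  rewrite mulrA mulrC [t * l]mulrC ltr_pM2l//.
  by apply: lt_le_trans (expR_ge1Dx _); rewrite ltrDr.
have := le_lt_trans h1 (lt_trans te h2).
by rewrite ltr_pM2r ?expR_gt0// ltr_pM2l// ltr_pXn2r// nnegrE// ltW.
Unshelve. all: by end_near. Qed.

Lemma ball_subset_quadrant (R : realType) (c x : 'rV[R]_2) (r : R) :
  r <= c 0 0 -> r <= c 0 1 -> `|x - c| < r -> quadrant x.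
Proof.
move=> c0 c1 xr.
have h j : r <= c 0 j -> 0 <= x 0 j.
  move=> cj; have := mx_entry_le (x - c) 0 j; rewrite !mxE => /le_lt_trans/(_ xr).
  by rewrite ltr_norml => /andP[]; lra.
by split; exact: h.
Qed.

Lemma forward_solution_continuous (R : realType) (F : 'rV[R]_2 -> 'rV[R]_2)
    (T : \bar R) (x : R -> 'rV[R]_2) t :
  forward_solution F T x -> 0 < t -> (t%:E < T)%E -> {for t, continuous x}.
Proof. by move=> [_ dx _] t0 tT; exact: is_derive_continuous (dx t t0 tT). Qed.

(** Trapping gives stability; it also keeps the Picard curve in the ball, making it a global forward
    solution, and keeps every forward solution started nearby in the region of decay. *)
Theorem lyapunov_asymptotic_stability (R : realType)
    (F : 'rV[R]_2 -> 'rV[R]_2) (c : 'rV[R]_2) (p s w m k r : R) :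
  0 < c 0 0 -> 0 < c 0 1 -> F c = 0 -> lipschitz_at F c ->
  0 < m -> 0 < k -> 0 < r ->
  (forall z, m * `|z| ^+ 2 <= qform p s w z) ->
  (forall x, `|x - c| < r -> qform_dot p s w (x - c) (F x) <= - k * `|x - c| ^+ 2) ->
  locally_asymptotically_stable F c.
Proof.
move=> c0 c1 Fc0 [L [rL [L0 rL0 FL]]] m0 k0 r0 Qm Qdot.
have Qdot0 x : `|x - c| < r -> qform_dot p s w (x - c) (F x) <= 0.
  by move=> /Qdot/le_trans; apply; rewrite mulNr oppr_le0 mulr_ge0 ?sqr_ge0// ltW.
split.
- by split => //; split; exact: ltW.
- move=> e e0.
  have er : Num.min e (r / 2) < r by rewrite gt_min; apply/orP; right; lra.
  have e'0 : 0 < Num.min e (r / 2) by rewrite lt_min e0 divr_gt0.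
  have [d d0 hd] := lyapunov_trap m0 e'0 er Qm Qdot0.
  exists d => // T x T0 fx xd t t0 tT.
  have [cx0 dx _] := fx.
  apply: (@lt_le_trans _ _ (Num.min e (r / 2))); last by rewrite ge_min lexx.
  apply: (hd T x cx0 _ _ xd t t0 tT) => u u0 uT; last by move=> _; exact: dx.
  exact: forward_solution_continuous fx u0 uT.
(* [rho] respects the decay radius, the Lipschitz radius on the closed ball, and the distance of [c]
   from the axes, so that the ball lies in the quadrant. *)
- pose rho := Num.min (Num.min r (rL / 2)) (Num.min (c 0 0) (c 0 1)).
  have rho0 : 0 < rho by rewrite !lt_min r0 divr_gt0// c0.
  have rho_r : rho <= r by rewrite !ge_min lexx.
  have rho_L : rho < rL.
    by rewrite !gt_min; apply/orP; left; apply/orP; right; lra.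
  have rho_c0 : rho <= c 0 0 by rewrite !ge_min lexx !orbT.
  have rho_c1 : rho <= c 0 1 by rewrite !ge_min lexx !orbT.
  have rho2 : rho / 2 < rho by lra.
  have rho20 : 0 < rho / 2 by rewrite divr_gt0.
  have [|d d0 hd] := @lyapunov_trap R F c p s w m rho (rho / 2) m0 rho20 rho2 Qm.
    by move=> x xr; apply: Qdot0; exact: lt_le_trans rho_r.
  exists d => // y _ yd; split.
    have [|x [cx x0 dx]] := @picard_local R 2 F c y L rho L0 rho0.
      by move=> u v ue ve; apply: FL; exact: le_lt_trans rho_L.
    have cx0 : x t @[t --> 0^'+] --> x 0 by apply: cvg_at_right_filter; exact: cx.
    have xe t : 0 <= t -> `|x t - c| < rho / 2.
      move=> t0; apply: (hd +oo%E x cx0 _ _ _ t t0 (ltry t)).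
      - by move=> u _ _; exact: cx.
      - by move=> u u0 _ /ltW; exact: dx.
      - by rewrite x0.
    exists x => //; split => //.
      by move=> t t0 _; apply: dx => //; apply/ltW/(lt_trans _ rho2)/xe/ltW.
    by move=> t t0 _; apply: (ball_subset_quadrant rho_c0 rho_c1); exact/(lt_trans _ rho2)/xe.
  move=> x fx x0; have [cx0 dx _] := fx.
  apply: (@lyapunov_decay R F c p s w m k r x) => //.
    by move=> t t0; apply: dx => //; rewrite ltry.
  move=> t t0; apply: lt_le_trans rho_r; apply: lt_trans rho2.
  apply: (hd +oo%E x cx0 _ _ _ t t0 (ltry t)).
  - by move=> u u0 uT; exact: forward_solution_continuous fx u0 uT.
  - by move=> u u0 _ _; exact: dx u u0 (ltry u).
  - by rewrite x0.
Qed.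

(* The form need not be definite: it only has to be positive somewhere and to
   grow along solutions. *)
Theorem lyapunov_instability (R : realType)
    (F : 'rV[R]_2 -> 'rV[R]_2) (c z0 : 'rV[R]_2) (p s w k r : R) :
  0 < c 0 0 -> 0 < c 0 1 -> lipschitz_at F c ->
  0 < k -> 0 < r -> 0 < qform p s w z0 ->
  (forall x, `|x - c| < r -> k * `|x - c| ^+ 2 <= qform_dot p s w (x - c) (F x)) ->
  ~ lyapunov_stable F c.
Proof.
move=> c0 c1 [L [rL [L0 rL0 FL]]] k0 r0 Qz0 Qdot stab.
pose rho := Num.min (Num.min (r / 2) (rL / 2)) (Num.min (c 0 0) (c 0 1)).
have rho0 : 0 < rho by rewrite !lt_min !divr_gt0// c0.
have rho_r : rho < r by rewrite !gt_min; apply/orP; left; apply/orP; left; lra.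
have rho_L : rho < rL by rewrite !gt_min; apply/orP; left; apply/orP; right; lra.
have rho_c0 : rho <= c 0 0 by rewrite !ge_min lexx !orbT.
have rho_c1 : rho <= c 0 1 by rewrite !ge_min lexx !orbT.
have rho20 : 0 < rho / 2 by rewrite divr_gt0.
have rho2 : rho / 2 < rho by lra.
have [d d0 hd] := stab _ rho20.
have z0n : 0 < `|z0|.
  rewrite normr_gt0; apply: contraTneq Qz0 => ->.
  by rewrite /qform !mxE !expr0n /= !mulr0 !addr0 ltxx.
pose e := Num.min d rho / 2.
have e0 : 0 < e by rewrite divr_gt0// lt_min d0.
have ed : e < d by rewrite /e ltr_pdivrMr// gt_min; apply/orP; left; lra.
have erho : e < rho by rewrite /e ltr_pdivrMr// gt_min; apply/orP; right; lra.
(* The start [c + a *: z0] lies at distance [e] from [c], below both [d] and [rho], in a direction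
   where the form is positive. *)
pose a := e / `|z0|.
have a0 : 0 < a by rewrite divr_gt0.
have [|x [cx x0 dx]] := @picard_local R 2 F c (c + a *: z0) L rho L0 rho0.
  by move=> u v ue ve; apply: FL; exact: le_lt_trans rho_L.
have x0c : x 0 - c = a *: z0 by rewrite x0 addrC addKr.
have nx0 : `|x 0 - c| = e by rewrite x0c normrZ gtr0_norm// divfK// gt_eqF.
have cxr t : x u @[u --> t^'+] --> x t by apply: cvg_at_right_filter; exact: cx.
(* Stability is applied on [[0, u[] with [T = u]: the curve counts as a forward solution only up to
   a time for which it is known to stay in the ball. *)
have xrho t : 0 <= t -> `|x t - c| < rho.
  move=> t0; apply: (@real_induction R (fun t => `|x t - c| < rho) 0 t) => //.
  - by rewrite nx0.
  - move=> u u0 ut hu; apply: le_lt_trans rho2.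
    apply: (@cvg_le_near R (fun v => `|x v - c|) u _ u0).
      by apply: cvg_norm; apply: (cvgB (cx u)); exact: cvg_cst.
    move=> v v0 vu; apply: (hd u%:E x) => //; rewrite ?lte_fin ?nx0//.
    split => //.
      by move=> q q0; rewrite lte_fin => qu; apply: dx => //; apply/ltW/hu => //; exact: ltW.
    move=> q q0; rewrite lte_fin => qu.
    by apply: (ball_subset_quadrant rho_c0 rho_c1); exact: hu.
  - move=> u u0 ut hu; apply: right_continuous_lt; last exact: hu.
    by apply: cvg_norm; apply: (cvgB (cxr u)); exact: cvg_cst.
pose V u := qform p s w (x u - c).
pose W u := qform_dot p s w (x u - c) (F (x u)).
have dV (u : R) : 0 < u -> is_derive u 1 V (W u).
  by move=> u0; apply: is_derive_qform; apply: dx => //; exact/ltW/xrho/ltW.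
have Wk (u : R) : 0 <= u -> k * `|x u - c| ^+ 2 <= W u.
  by move=> u0; apply: Qdot; exact/(lt_trans _ rho_r)/xrho.
have V0 : 0 < V 0.
  rewrite /V x0c /qform !mxE.
  have -> : p * (a * z0 0 0) ^+ 2 + 2 * s * (a * z0 0 0 * (a * z0 0 1)) +
    w * (a * z0 0 1) ^+ 2 = a ^+ 2 * qform p s w z0 by rewrite /qform; ring.
  by rewrite mulr_gt0// exprn_gt0.
pose M := `|p| + 2 * `|s| + `|w| + 1.
have M0 : 0 < M by rewrite ltr_wpDl// !addr_ge0// mulr_ge0.
have QM z : qform p s w z <= M * `|z| ^+ 2.
  by rewrite (le_trans (qform_le _ _ _ _))// ler_wpM2r ?sqr_ge0// lerDl.
have cV0 : V u @[u --> 0^'+] --> V 0.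
  apply: (@continuous_cvg _ _ _ _ _ x (fun y => qform p s w (y - c))) (cxr 0).
  exact: qform_continuous.
have Vmono (u : R) : 0 <= u -> V 0 <= V u.
  move=> u0; rewrite -lerN2.
  apply: (@nonincreasing_deriv R (fun v => - V v) (fun v => - W v) 0 u _ _ _ u u0 (lexx u)).
  - exact: cvgN.
  - by move=> v v0 _; apply: is_deriveN; exact: dV.
  - move=> v v0 _; rewrite oppr_le0 (le_trans _ (Wk v (ltW v0)))//.
    by rewrite mulr_ge0 ?sqr_ge0// ltW.
pose g := k / M * V 0.
have g0 : 0 < g by rewrite mulr_gt0// divr_gt0.
have Wg (u : R) : 0 <= u -> g <= W u.
  move=> u0; apply: le_trans (Wk u u0); rewrite /g -mulrA ler_pM2l// mulrC.
  rewrite ler_pdivrMr//; apply: (le_trans (Vmono u u0)); rewrite mulrC; exact: QM.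
have Vlin (u : R) : 0 <= u -> V 0 + g * u <= V u.
  move=> u0; have := @nonincreasing_deriv R (fun v => g * v - V v)
    (fun v => g * 1 - W v) 0 u _ _ _ u u0 (lexx u).
  move=> h; suff : g * u - V u <= g * 0 - V 0 by lra.
  apply: h.
  - have h1 : g * v @[v --> 0^'+] --> g * 0.
      by apply: cvgM; [exact: cvg_cst|apply: cvg_at_right_filter; exact: cvg_id].
    exact: (cvgB h1 cV0).
  - move=> v v0 _; have h0 : is_derive v 1 (fun v => g * v) (g * 1).
      exact: (@is_deriveZ _ _ _ id).
    exact: (is_deriveB h0 (dV v v0)).
  - by move=> v v0 _; rewrite mulr1 subr_le0; exact/Wg/ltW.
(* At this time the linear growth of [V] exceeds by [V 0] the bound [M * rho ^+ 2] valid in the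
   ball. *)
pose t := M * rho ^+ 2 / g.
have t0 : 0 <= t by apply: divr_ge0; [apply: mulr_ge0; [exact: ltW|exact: sqr_ge0]|exact: ltW].
have h1 := Vlin t t0; have h2 := QM (x t - c).
have h3 : M * `|x t - c| ^+ 2 <= M * rho ^+ 2.
  by rewrite ler_pM2l// ler_pXn2r ?nnegrE// ltW// xrho.
have : g * t = M * rho ^+ 2 by rewrite /t mulrC divfK// gt_eqF.
by move: h1 h2 h3 V0; rewrite /V; lra.
Qed.

(** * Linearization at a fixed point *)

Lemma posdef_coercive (R : realType) (A B C : R) :
  0 < A -> 0 < 4 * A * C - B ^+ 2 ->
  exists2 k, 0 < k & forall x y,
    k * (x ^+ 2 + y ^+ 2) <= A * x ^+ 2 + B * (x * y) + C * y ^+ 2.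
Proof.
move=> A0 D0.
have C0 : 0 < C.
  have : 0 < 4 * A * C by have := sqr_ge0 B; lra.
  by rewrite pmulr_rgt0// mulr_gt0.
have AC0 : 0 < A + C by exact: addr_gt0.
(* Determinant over trace of the symmetric matrix of the form, a lower bound for its smaller
   eigenvalue. Completing the square then leaves the remainder [4 * k ^+ 2 * y ^+ 2]. *)
pose k := (4 * A * C - B ^+ 2) / (4 * (A + C)).
have k0 : 0 < k by rewrite divr_gt0// mulr_gt0.
have kE : 4 * (k * (A + C)) = 4 * A * C - B ^+ 2 by rewrite /k; field; rewrite gt_eqF.
exists k => // x y.
have kA : 0 < A - k.
  have : k * (A + C) <= A * C by have := sqr_ge0 B; lra.
  by have := mulr_gt0 k0 A0; have := mulr_gt0 A0 A0; nra.
rewrite -subr_ge0 -(pmulr_rge0 _ (_ : 0 < 4 * (A - k))) ?mulr_gt0//.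
have -> : 4 * (A - k) * (A * x ^+ 2 + B * (x * y) + C * y ^+ 2 - k * (x ^+ 2 + y ^+ 2))
  = (2 * (A - k) * x + B * y) ^+ 2 +
    (4 * A * C - B ^+ 2 - 4 * (k * (A + C)) + 4 * k ^+ 2) * y ^+ 2 by ring.
rewrite kE subrr add0r addr_ge0 ?sqr_ge0// mulr_ge0 ?sqr_ge0// mulr_ge0 ?sqr_ge0//.
Qed.

(** The matrix with rows [(- a, - b)] and [(c, - (d + j))] is stable for each [j], but the slope [j]
    varies along a solution, so the form must not depend on it. *)
Lemma common_lyapunov (R : realType) (a b c d e : R) :
  0 < a -> 0 < c -> 0 <= d -> 0 <= e -> 0 < a * d + b * c ->
  exists p s w m k, [/\ 0 < m, 0 < k,
    forall x y, m * (x ^+ 2 + y ^+ 2) <= p * x ^+ 2 + 2 * s * (x * y) + w * y ^+ 2 &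
    forall j x y, 0 <= j -> j <= e ->
      2 * ((p * x + s * y) * (- (a * x) - b * y) +
           (s * x + w * y) * (c * x - (d + j) * y)) <= - k * (x ^+ 2 + y ^+ 2)].
Proof.
move=> a0 c0 d0 e0 det0.
(* The derivative is affine in [j], so its sign need only be checked for
   [j = 0] and [j = e]. *)
suff [p [s [w [A0 D0 h]]]] : exists p s w, [/\ 0 < p, 0 < 4 * p * w - (2 * s) ^+ 2 &
    forall j, j = 0 \/ j = e -> 0 < p * a - s * c /\
      0 < 4 * (p * a - s * c) * (s * b + w * (d + j)) -
        (p * b + s * a - w * c + s * (d + j)) ^+ 2].
  have [m m0 hm] := posdef_coercive A0 D0.
  have [A1 D1] := h 0 (or_introl erefl); have [A2 D2] := h e (or_intror erefl).
  have [k1 k10 hk1] := posdef_coercive A1 D1.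
  have [k2 k20 hk2] := posdef_coercive A2 D2.
  pose k := Num.min k1 k2.
  have k0 : 0 < k by rewrite lt_min k10.
  have kk1 : k <= k1 by rewrite ge_min lexx.
  have kk2 : k <= k2 by rewrite ge_min lexx orbT.
  exists p, s, w, m, (2 * k); split => //; first by rewrite mulr_gt0.
  move=> j x y j0 je.
  have S0 : 0 <= x ^+ 2 + y ^+ 2 by rewrite addr_ge0 ?sqr_ge0.
  have h1 := hk1 x y; have h2 := hk2 x y.
  have g1 : k * (x ^+ 2 + y ^+ 2) <= k1 * (x ^+ 2 + y ^+ 2) by rewrite ler_wpM2r.
  have g2 : k * (x ^+ 2 + y ^+ 2) <= k2 * (x ^+ 2 + y ^+ 2) by rewrite ler_wpM2r.
  have f1 := le_trans g1 h1; have f2 := le_trans g2 h2.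
  have [ez|ez] := eqVneq e 0.
    have j0' : j = 0 by apply/eqP; rewrite eq_le j0 -ez je.
    by rewrite j0'; lra.
  have ep : 0 < e by rewrite lt_def ez.
  pose u := j / e.
  have u0 : 0 <= u by rewrite divr_ge0.
  have u1 : 0 <= 1 - u by rewrite subr_ge0 ler_pdivrMr// mul1r.
  have uj : j = u * e by rewrite divfK.
  have := lerD (ler_wpM2l u1 f1) (ler_wpM2l u0 f2).
  by rewrite uj; lra.
(* For [b <= 0] the condition forces [d > 0] and [- b * c < a * d]; the diagonal form with weights
   [c] and [a * d / c] then leaves a cross coefficient of size below [2 * a * d]. *)
have [bn|bp] := leP b 0.
  have d1 : 0 < d.
    rewrite lt_def d0 andbT; apply: contraTneq det0 => ->.
    by rewrite mulr0 add0r -leNgt mulr_le0_ge0// ltW.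
  exists c, 0, (a * d / c); split => //.
    by rewrite mulr0 expr0n /= subr0 !mulr_gt0// invr_gt0.
  move=> j hj; have j0 : 0 <= j by case: hj => ->.
  rewrite !mul0r !subr0 !addr0 add0r; split; first exact: mulr_gt0.
  have -> : 4 * (c * a) * (a * d / c * (d + j)) = 4 * (a * d) ^+ 2 + 4 * a ^+ 2 * d * j.
    by field; rewrite gt_eqF.
  have -> : c * b - a * d / c * c = - (a * d - b * c) by field; rewrite gt_eqF.
  have : 0 <= 4 * a ^+ 2 * d * j by rewrite mulr_ge0// mulr_ge0// mulr_ge0// sqr_ge0.
  have ad0 : 0 < a * d by rewrite mulr_gt0.
  have bc0 : b * c <= 0 by rewrite mulr_le0_ge0// ltW.
  by nra.
(* For [b > 0] the weights [c] and [b] cancel the cross terms, but definiteness in [y] is lost when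
   [d + j = 0]; a small mixed coefficient [s] adds [s * b] there. [D] bounds the factor [a + d + j]
   of the new cross term. *)
pose D := a + d + e.
have D0 : 0 < D by rewrite !ltr_wpDr.
have cab : 0 < c * a * b by rewrite !mulr_gt0.
(* Each bound serves one estimate: [a / 2] keeps half of [c * a], [c * a * b / D ^+ 2] controls the
   new cross term, and [c / 2], [b / 2] keep the form definite. *)
pose s := Num.min (Num.min (a / 2) (c * a * b / D ^+ 2)) (Num.min (c / 2) (b / 2)).
have s0 : 0 < s by rewrite !lt_min !divr_gt0// exprn_gt0.
have sa : s <= a / 2 by rewrite !ge_min lexx.
have sD : s * D ^+ 2 <= c * a * b.
  by rewrite -ler_pdivlMr ?exprn_gt0// !ge_min lexx !orbT.
have sc : s <= c / 2 by rewrite !ge_min lexx !orbT.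
have sb : s <= b / 2 by rewrite !ge_min lexx !orbT.
exists c, s, b; split => //.
  have : s * s <= c / 2 * (b / 2) by rewrite ler_pM// ltW.
  by have := mulr_gt0 c0 bp; rewrite expr2; lra.
move=> j hj; have [j0 je] : 0 <= j /\ j <= e by case: hj => ->.
have h1 : 0 < c * a - s * c by rewrite mulrC -mulrBl mulr_gt0// subr_gt0; lra.
split => //.
have -> : c * b + s * a - b * c + s * (d + j) = s * (a + d + j) by ring.
have h2 : (s * (a + d + j)) ^+ 2 <= s * (c * a * b).
  rewrite exprMn expr2 -mulrA ler_pM2l//; apply: le_trans sD.
  by rewrite ler_pM2l// !expr2; apply: ler_pM; rewrite /D; lra.
have h3 : 2 * (c * a) <= 4 * (c * a - s * c).
  by have := ler_wpM2l (ltW c0) sa; lra.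
have h4 : s * b <= s * b + b * (d + j) by rewrite lerDl mulr_ge0 ?addr_ge0// ltW.
have h5 : 2 * (c * a) * (s * b) <= 4 * (c * a - s * c) * (s * b + b * (d + j)).
  by apply: ler_pM => //; rewrite ltW// !mulr_gt0.
have := mulr_gt0 s0 cab; lra.
Qed.

Lemma vec2E0 (R : realType) (a b : R) : vec2 a b 0 0 = a.
Proof. by rewrite mxE. Qed.

Lemma vec2E1 (R : realType) (a b : R) : vec2 a b 0 1 = b.
Proof. by rewrite mxE. Qed.

Lemma vec2_norm_le (R : realType) (a b e : R) :
  `|a| <= e -> `|b| <= e -> `|vec2 a b| <= e.
Proof.
move=> ae be; apply: mx_norm_le => [|i j]; first exact: le_trans ae.
by rewrite mxE; case: ifP.
Qed.

Lemma rV2_eqP (R : realType) (x y : 'rV[R]_2) :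
  x 0 0 = y 0 0 -> x 0 1 = y 0 1 -> x = y.
Proof.
move=> h0 h1; apply/rowP => -[[|[|//]] hj].
  by rewrite (_ : Ordinal hj = 0)//; exact/val_inj.
by rewrite (_ : Ordinal hj = 1)//; exact/val_inj.
Qed.

Lemma qform_dotD (R : realType) (p s w : R) (z u v : 'rV[R]_2) :
  qform_dot p s w z (u + v) = qform_dot p s w z u + qform_dot p s w z v.
Proof. rewrite /qform_dot !mxE; ring. Qed.

Lemma qform_dot_le (R : realType) (p s w : R) (z v : 'rV[R]_2) :
  `|qform_dot p s w z v| <= 2 * (`|p| + 2 * `|s| + `|w|) * (`|z| * `|v|).
Proof.
have h a i j : `|a * (z 0 i * v 0 j)| <= `|a| * (`|z| * `|v|).
  by rewrite !normrM ler_wpM2l// ler_pM// mx_entry_le.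
have -> : qform_dot p s w z v = 2 * (p * (z 0 0 * v 0 0) + s * (z 0 1 * v 0 0) +
   (s * (z 0 0 * v 0 1) + w * (z 0 1 * v 0 1))) by rewrite /qform_dot; ring.
rewrite normrM ger0_norm// -mulrA ler_pM2l//.
rewrite (le_trans (ler_normD _ _))// (le_trans (lerD (ler_normD _ _) (ler_normD _ _)))//.
have := h p 0 0; have := h s 1 0; have := h s 0 1; have := h w 1 1; lra.
Qed.

(** Differentiability of the map sending [x] to [g (x 0 1) * x 0 0], in explicit form. With the
    Caratheodory slope [h] of [g] at [q0], the remainder splits into a quadratic term and a term
    with [h - dg], each given half of [e]. *)
Lemma product_expansion (R : realType) (g : R -> R) (dg r0 q0 e : R) :
  is_derive q0 1 g dg -> 0 < e ->
  exists2 rho, 0 < rho & forall x : 'rV[R]_2, `|x - vec2 r0 q0| < rho ->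
    `|g (x 0 1) * x 0 0 - g q0 * r0
      - (g q0 * (x 0 0 - r0) + r0 * dg * (x 0 1 - q0))| <= e * `|x - vec2 r0 q0|.
Proof.
move=> /is_derive1_caratheodory[h [gh ch hq]] e0.
pose d1 := e / (2 * (`|r0| + 1)).
have r01 : 0 < `|r0| + 1 by rewrite ltr_wpDl.
have d10 : 0 < d1 by rewrite divr_gt0// mulr_gt0.
pose H := `|dg| + d1.
have H0 : 0 < H by rewrite ltr_wpDl.
have : \forall z \near q0, `|h z - dg| < d1.
  by near=> z; rewrite -hq distrC; near: z; exact: cvgr_dist_lt.
move=> /nbhs_normP[rho /= rho0 hrho].
exists (Num.min rho (e / (2 * H))).
  by rewrite lt_min rho0 divr_gt0// mulr_gt0.
move=> x; rewrite lt_min => /andP[xrho xH].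
set N := `|x - _| in xrho xH *.
have xr : `|x 0 0 - r0| <= N.
  by have := mx_entry_le (x - vec2 r0 q0) 0 0; rewrite !mxE.
have xq : `|x 0 1 - q0| <= N.
  by have := mx_entry_le (x - vec2 r0 q0) 0 1; rewrite !mxE.
have hx : `|h (x 0 1) - dg| <= d1.
  by apply/ltW/hrho; rewrite /= distrC; exact: le_lt_trans xrho.
have hH : `|h (x 0 1)| <= H.
  by rewrite -(subrK dg (h _)) (le_trans (ler_normD _ _))// addrC lerD2l.
have -> : g (x 0 1) * x 0 0 - g q0 * r0 - (g q0 * (x 0 0 - r0) + r0 * dg * (x 0 1 - q0)) =
    h (x 0 1) * (x 0 0 - r0) * (x 0 1 - q0) + r0 * (h (x 0 1) - dg) * (x 0 1 - q0).
  rewrite (_ : g (x 0 1) = g q0 + h (x 0 1) * (x 0 1 - q0)); first by ring.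
  by rewrite -gh addrC subrK.
rewrite (le_trans (ler_normD _ _))// !normrM -mulrDl ler_pM//.
rewrite (splitr e) lerD//.
  apply: (@le_trans _ _ (H * N)); first by rewrite ler_pM.
  by move/ltW : xH; rewrite ler_pdivlMr ?mulr_gt0//; lra.
apply: (@le_trans _ _ (`|r0| * d1)); first by rewrite ler_wpM2l.
have : (`|r0| + 1) * d1 = e / 2 by rewrite /d1; field; rewrite gt_eqF.
by rewrite mulrDl mul1r; lra.
Unshelve. all: by end_near. Qed.

(** [mu] is left as an increment, since it may have no derivative at [q0]; the equilibrium equations
    remove the constant terms. *)
Lemma vfield_expansion (R : realType) (K : R) (f p alpha mu : R -> R)
    (r0 q0 dphi dalpha e : R) :
  is_derive q0 1 (f \o p) dphi -> is_derive q0 1 alpha dalpha ->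
  (f (p q0) + alpha q0) * r0 = K -> alpha q0 * r0 = mu q0 -> 0 < e ->
  exists2 rho, 0 < rho & forall x, `|x - vec2 r0 q0| < rho ->
    `|vfield K f p alpha mu x -
      vec2 (- ((f (p q0) + alpha q0) * (x 0 0 - r0)) - r0 * (dphi + dalpha) * (x 0 1 - q0))
        (alpha q0 * (x 0 0 - r0) - - (r0 * dalpha) * (x 0 1 - q0) - (mu (x 0 1) - mu q0))|
    <= e * `|x - vec2 r0 q0|.
Proof.
move=> dF dA EK Emu e0.
have [rho1 rho10 h1] := product_expansion r0 (is_deriveD dF dA) e0.
have [rho2 rho20 h2] := product_expansion r0 dA e0.
exists (Num.min rho1 rho2); first by rewrite lt_min rho10.
move=> x; rewrite lt_min => /andP[/h1 + /h2].
set N := e * _ => {}h1 {}h2.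
set v := (X in `|X| <= N).
have -> : v = vec2 (v 0 0) (v 0 1) by apply: rV2_eqP; rewrite ?vec2E0 ?vec2E1.
apply: vec2_norm_le; rewrite /v !mxE /=.
  rewrite -normrN; apply: le_trans h1; rewrite le_eqVlt; apply/orP; left; apply/eqP.
  by congr `| _ |; rewrite -EK !fctE /=; ring.
apply: le_trans h2; rewrite le_eqVlt; apply/orP; left; apply/eqP.
by congr `| _ |; rewrite -Emu; ring.
Qed.

(** Makes the expansion error of the field, which is small relative to [z], a quadratic error that
    the definite derivative of the linear part can absorb. *)
Lemma qform_dot_perturb (R : realType) (p s w k : R) :
  0 < k -> exists2 e, 0 < e & forall z u v : 'rV[R]_2, `|u - v| <= e * `|z| ->
    `|qform_dot p s w z u - qform_dot p s w z v| <= k * `|z| ^+ 2.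
Proof.
move=> k0; pose M := 2 * (`|p| + 2 * `|s| + `|w|) + 1.
have M0 : 0 < M by rewrite ltr_wpDl// mulr_ge0// !addr_ge0// mulr_ge0.
exists (k / M); first exact: divr_gt0.
move=> z u v uv.
have -> : qform_dot p s w z u - qform_dot p s w z v = qform_dot p s w z (u - v).
  by have := qform_dotD p s w z (u - v) v; rewrite subrK => ->; rewrite addrK.
rewrite (le_trans (qform_dot_le _ _ _ _ _))//.
apply: (@le_trans _ _ (M * (`|z| * `|u - v|))).
  by rewrite ler_wpM2r ?mulr_ge0// lerDl.
have -> : k * `|z| ^+ 2 = M * (`|z| * (k / M * `|z|)) by field; rewrite gt_eqF.
by rewrite ler_pM2l// ler_wpM2l.
Qed.

(** The inequality between [f (p q0) * dalpha] and [alpha q0 * dphi] is [a d + b c > 0] divided by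
    [r0]. Half of the decay rate [k] of the linear family pays for the expansion error. *)
Lemma vfield_stable (R : realType) (K : R) (f p alpha mu : R -> R)
    (r0 q0 dphi dalpha e : R) :
  is_derive q0 1 (f \o p) dphi -> is_derive q0 1 alpha dalpha ->
  (f (p q0) + alpha q0) * r0 = K -> alpha q0 * r0 = mu q0 ->
  0 < r0 -> 0 < q0 -> 0 <= f (p q0) -> 0 < alpha q0 -> dalpha <= 0 -> 0 <= e ->
  f (p q0) * dalpha < alpha q0 * dphi ->
  (forall q, exists j, [/\ 0 <= j, j <= e & mu q - mu q0 = j * (q - q0)]) ->
  lipschitz_at (vfield K f p alpha mu) (vec2 r0 q0) ->
  locally_asymptotically_stable (vfield K f p alpha mu) (vec2 r0 q0).
Proof.
move=> dF dA EK Emu r00 q00 f0 a0 dA0 e0 det mul lip.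
set F := vfield K f p alpha mu in lip *; set c := vec2 r0 q0 in lip *.
have A0 : 0 < f (p q0) + alpha q0 by rewrite ltr_wpDl.
have d0 : 0 <= - (r0 * dalpha) by rewrite oppr_ge0 mulr_ge0_le0// ltW.
have det0 : 0 < (f (p q0) + alpha q0) * - (r0 * dalpha) + r0 * (dphi + dalpha) * alpha q0.
  have : 0 < r0 * (alpha q0 * dphi - f (p q0) * dalpha) by rewrite mulr_gt0// subr_gt0.
  by lra.
have [P [S [W [m [k [m0 k0 Qm Qdot]]]]]] := common_lyapunov A0 a0 d0 e0 det0.
have k20 : 0 < k / 2 by rewrite divr_gt0.
have [eps eps0 hpert] := qform_dot_perturb P S W k20.
have [rho rho0 hrho] := vfield_expansion dF dA EK Emu eps0.
apply: (@lyapunov_asymptotic_stability R F c P S W m (k / 2) rho) => //.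
- by rewrite vec2E0.
- by rewrite vec2E1.
- apply: rV2_eqP; rewrite /F /vfield ?vec2E0 ?vec2E1 !mxE /=.
    by rewrite -EK; ring.
  by rewrite Emu subrr.
- move=> z; apply: le_trans (Qm _ _); rewrite ler_pM2l//; exact: norm_rV2_sqr.
- move=> x xr.
  have := hpert (x - c) _ _ (hrho x xr).
  have [j [j0 je ->]] := mul (x 0 1).
  set v := vec2 _ _; rewrite ler_norml => /andP[_ hv].
  have := Qdot j (x 0 0 - r0) (x 0 1 - q0) j0 je.
  have -> : 2 * ((P * (x 0 0 - r0) + S * (x 0 1 - q0)) *
     (- ((f (p q0) + alpha q0) * (x 0 0 - r0)) - r0 * (dphi + dalpha) * (x 0 1 - q0)) +
     (S * (x 0 0 - r0) + W * (x 0 1 - q0)) *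
     (alpha q0 * (x 0 0 - r0) - (- (r0 * dalpha) + j) * (x 0 1 - q0))) =
     qform_dot P S W (x - c) v.
    rewrite /qform_dot /v vec2E0 vec2E1 !mxE /=; ring.
  move=> hq.
  have hN : k * `|x - c| ^+ 2 <= k * ((x 0 0 - r0) ^+ 2 + (x 0 1 - q0) ^+ 2).
    by rewrite ler_pM2l//; have := norm_rV2_sqr (x - c); rewrite !mxE.
  by move: hv hq hN; rewrite /F; lra.
Qed.

Lemma vfield_saddle (R : realType) (K : R) (f p alpha mu : R -> R)
    (r0 q0 dphi dalpha : R) :
  is_derive q0 1 (f \o p) dphi -> is_derive q0 1 alpha dalpha ->
  (f (p q0) + alpha q0) * r0 = K -> alpha q0 * r0 = mu q0 ->
  0 < r0 -> 0 < q0 -> 0 <= f (p q0) -> 0 < alpha q0 -> dalpha <= 0 ->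
  alpha q0 * dphi < f (p q0) * dalpha ->
  (\forall q \near q0, mu q = mu q0) ->
  lipschitz_at (vfield K f p alpha mu) (vec2 r0 q0) ->
  unstable (vfield K f p alpha mu) (vec2 r0 q0).
Proof.
move=> dF dA EK Emu r00 q00 f0 a0 dA0 det mul lip.
set F := vfield K f p alpha mu in lip *; set c := vec2 r0 q0 in lip *.
have A0 : 0 < f (p q0) + alpha q0 by rewrite ltr_wpDl.
have [A hA] : exists A, A = f (p q0) + alpha q0 by eexists.
have [d hd] : exists d, d = - (r0 * dalpha) by eexists.
(* This [b] has the sign opposite to the overview; the determinant condition forces it to be
   positive. *)
have [b hb] : exists b, b = - (r0 * (dphi + dalpha)) by eexists.
have d0 : 0 <= d by rewrite hd oppr_ge0 mulr_ge0_le0// ltW.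
have det0 : A * d < b * alpha q0.
  have : 0 < r0 * (f (p q0) * dalpha - alpha q0 * dphi) by rewrite mulr_gt0// subr_gt0.
  by rewrite hA hb hd; lra.
have b0 : 0 < b.
  have : 0 < b * alpha q0 by apply: le_lt_trans det0; rewrite mulr_ge0// hA ltW.
  by rewrite pmulr_lgt0.
split.
  split; first by split; rewrite /c ?vec2E0 ?vec2E1 ltW.
  apply: rV2_eqP; rewrite /F /vfield ?vec2E0 ?vec2E1 !mxE /=.
    by rewrite -EK; ring.
  by rewrite Emu subrr.
pose h := Num.min (alpha q0) b.
have h0 : 0 < h by rewrite lt_min a0.
pose D := b * alpha q0 - A * d.
have D0 : 0 < D by rewrite subr_gt0.
have k0 : 0 < D * h by rewrite mulr_gt0.
(* With these coefficients the cross terms of the derivative cancel. *)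
pose P := alpha q0 * d; pose S := b * alpha q0; pose W := A * b.
have [eps eps0 hpert] := qform_dot_perturb P S W k0.
have [rho rho0 hrho] := vfield_expansion dF dA EK Emu eps0.
have /nbhs_normP[rho' /= rho'0 hrho'] := mul.
apply: (@lyapunov_instability R F c (vec2 1 1) P S W (D * h) (Num.min rho rho')) => //.
- by rewrite vec2E0.
- by rewrite vec2E1.
- by rewrite lt_min rho0.
- rewrite /qform vec2E0 vec2E1 !expr1n !mulr1 /P /S /W hA.
  by rewrite ltr_pwDr ?mulr_gt0// addr_ge0// ?mulr_ge0// ltW.
move=> x; rewrite lt_min => /andP[xr xr'].
have := hpert (x - c) _ _ (hrho x xr).
have -> : mu (x 0 1) = mu q0.
  apply: hrho'; rewrite /= distrC; apply: le_lt_trans xr'.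
  by have := mx_entry_le (x - c) 0 1; rewrite !mxE.
rewrite subrr subr0; set v := vec2 _ _; rewrite ler_norml => /andP[hv _].
have hN : D * h * `|x - c| ^+ 2 <=
    D * (alpha q0 * (x 0 0 - r0) ^+ 2 + b * (x 0 1 - q0) ^+ 2).
  rewrite -mulrA ler_pM2l//.
  apply: (@le_trans _ _ (h * ((x 0 0 - r0) ^+ 2 + (x 0 1 - q0) ^+ 2))).
    by rewrite ler_pM2l//; have := norm_rV2_sqr (x - c); rewrite !mxE.
  by rewrite mulrDr lerD// ler_wpM2r ?sqr_ge0// ge_min lexx ?orbT.
(* Of the factor 2, one half pays for the expansion error and the other remains as growth at rate
   [D * h]. *)
have hq : qform_dot P S W (x - c) v =
    2 * (D * (alpha q0 * (x 0 0 - r0) ^+ 2 + b * (x 0 1 - q0) ^+ 2)).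
  rewrite /qform_dot /v vec2E0 vec2E1 !mxE /= /P /S /W /D -hA -hd.
  have -> : r0 * (dphi + dalpha) = - b by rewrite hb opprK.
  by ring.
by move: hv hN; rewrite hq /F; lra.
Qed.

(** * Energy and periodic solutions *)

Lemma is_derive_local_le (R : realType) (u : R -> R) (t d D e : R) :
  is_derive t 1 u d -> d <= D -> 0 < e ->
  \forall s \near t, (t < s -> u s - u t <= (D + e) * (s - t)) /\
    (s < t -> u t - u s <= (D + e) * (t - s)).
Proof.
move=> /is_derive1_caratheodory[h [uh ch ht]] dD e0.
have de : h t < D + e by rewrite ht; lra.
near=> s.
have hs : h s < D + e by near: s; exact: cvgr_lt ch _ de.
split => st; first by rewrite uh ler_wpM2r ?subr_ge0 ?ltW.
by rewrite -opprB uh -mulrN opprB ler_wpM2r ?subr_ge0 ?ltW.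
Unshelve. all: by end_near. Qed.

(** Difference quotients bounded by every positive slope suffice, so [u] may have kinks. Real
    induction keeps [u] below a line of slope [e], and [e] is arbitrary. *)
Lemma nonincreasing_local (R : realType) (u : R -> R) :
  (forall t e, 0 < e -> \forall s \near t,
    (t < s -> u s - u t <= e * (s - t)) /\ (s < t -> u t - u s <= e * (t - s))) ->
  forall a b, a <= b -> u b <= u a.
Proof.
move=> hu a b ab; apply/ler_addgt0Pr => e0 e00.
pose e := e0 / (b - a + 1).
have ba0 : 0 < b - a + 1 by rewrite ltr_wpDl// subr_ge0.
have ep : 0 < e by rewrite divr_gt0.
suff h : u b <= u a + e * (b - a).
  apply: (le_trans h); rewrite lerD2l /e mulrAC ler_pdivrMr// ler_pM2l//; lra.
apply: (@real_induction R (fun t => u t <= u a + e * (t - a)) a b) => //.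
- by rewrite subrr mulr0 addr0.
- move=> t at_ tb ht; have /nbhs_normP[r /= r0 hr] := hu t e ep.
  pose s := Num.max a (t - r / 2).
  have st : s < t by rewrite gt_max at_/=; lra.
  have as_ : a <= s by rewrite le_max lexx.
  have : `|t - s| < r.
    rewrite gtr0_norm ?subr_gt0// ltrBlDr -ltrBlDl lt_max; apply/orP; right; lra.
  move=> /hr[_ /(_ st)]; have := ht s as_ st; lra.
- move=> t at_ tb ht; have /nbhs_normP[r /= r0 hr] := hu t e ep.
  exists r => // s ts str; have : `|t - s| < r.
    by rewrite distrC gtr0_norm ?subr_gt0//; lra.
  by move=> /hr[/(_ ts) + _]; have := ht t at_ (lexx t); lra.
Qed.

Lemma periodic_shift (R : realType) (V : Type) (x : R -> V) (T : R) (n : nat) :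
  (forall t, x (t + T) = x t) -> forall t, x (t + n%:R * T) = x t.
Proof.
move=> xT; elim: n => [|n ih] t; first by rewrite mul0r addr0.
by rewrite -natr1 mulrDl mul1r addrA xT.
Qed.

Lemma periodic_reduce (R : realType) (V : Type) (x : R -> V) (T : R) :
  0 < T -> (forall t, x (t + T) = x t) ->
  forall t, exists u, [/\ 0 <= u, u <= T & x u = x t].
Proof.
move=> T0 xT t; pose k := Num.floor (t / T).
have k1 : k%:~R * T <= t by rewrite -ler_pdivlMr// floor_le_tmp.
have k2 : t < (k + 1)%:~R * T by rewrite -ltr_pdivrMr// floorD1_gt.
exists (t - k%:~R * T); split; first by rewrite subr_ge0.
  by move: k2; rewrite intrD mulrDl mul1r; lra.
have [n [kn|kn]] : exists n : nat, k = n%:Z \/ k = - n%:Z.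
  by exists `|k|%N; case: (intP k) => [|m|m]; [left|left|right].
  rewrite -[in RHS](subrK (k%:~R * T) t) kn; apply/esym.
  by have := periodic_shift n xT (t - n%:R * T); rewrite pmulrn.
by rewrite kn mulrNz mulNr opprK; have := periodic_shift n xT t; rewrite pmulrn.
Qed.

Lemma periodic_nonincreasing_cst (R : realType) (u : R -> R) (T : R) :
  0 < T -> (forall t, u (t + T) = u t) -> (forall a b, a <= b -> u b <= u a) ->
  forall a b, u a = u b.
Proof.
move=> T0 uT hu; suff h a b : a <= b -> u a = u b.
  by move=> a b; case: (leP a b) => [|/ltW] /h.
move=> ab; apply/eqP; rewrite eq_le; apply/andP; split; last exact: hu.
have [n hn] : exists n : nat, b <= a + n%:R * T.
  exists (Num.bound ((b - a) / T)); rewrite -lerBlDl -ler_pdivrMr//.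
  by apply/ltW/archi_boundP; rewrite divr_ge0 ?subr_ge0// ltW.
by rewrite -(periodic_shift n uT a) hu.
Qed.

(** In this form the price is visibly Lipschitz, so its kinks need no separate treatment. *)
Lemma price_tent (R : realType) (beta qm q : R) : 0 < beta -> 0 <= q ->
  price beta qm q = Num.max (beta * (qm - `|q - qm|)) 0.
Proof.
move=> b0 q0; rewrite /price.
have [qqm|qmq] := leP q qm.
  by rewrite ler0_norm ?subr_le0// (_ : qm - - (q - qm) = q) ?max_l ?mulr_ge0 ?(ltW b0)//; ring.
rewrite gtr0_norm ?subr_gt0// (_ : qm - (q - qm) = 2 * qm - q); last by ring.
have [q2|q2] := leP q (2 * qm).
  by rewrite max_l// mulr_ge0 ?(ltW b0)// subr_ge0.
by rewrite max_r// pmulr_rle0// subr_le0 ltW.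
Qed.

Lemma price_ge0 (R : realType) (beta qm q : R) : 0 < beta -> 0 <= q ->
  0 <= price beta qm q.
Proof. by move=> b0 q0; rewrite price_tent// le_max lexx orbT. Qed.

Lemma price_continuous (R : realType) (beta qm q : R) : 0 < beta -> 0 < q ->
  {for q, continuous (price beta qm)}.
Proof.
move=> b0 q0.
have : {for q, continuous (fun q => Num.max (beta * (qm - `|q - qm|)) 0)}.
  apply: (@lipschitz_continuous _ _ _ _ beta) => // a b.
  rewrite (le_trans (max_lipschitz _ _ _))// -mulrBr normrM gtr0_norm//.
  have -> : qm - `|a - qm| - (qm - `|b - qm|) = `|b - qm| - `|a - qm| by ring.
  rewrite ler_pM2l// (le_trans (ler_dist_dist _ _))//.
  by rewrite (_ : b - qm - (a - qm) = b - a) ?[`|b - a|]distrC//; ring.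
rewrite /prop_for /continuous_at price_tent ?(ltW q0)//.
apply: cvg_trans; apply: near_eq_cvg; near=> z.
by rewrite price_tent// ltW//; near: z; exact: lt_nbhsr.
Unshelve. all: by end_near. Qed.

(** The identity behind the energy argument: along a solution, with
    [v = alpha(q) R - m(q) = q'],
    [(v^2 / (2 alpha) - G)' = - v^2 / alpha * (A + m' - alpha' (R + m / alpha) / 2)]. *)
Lemma energy_derivative_le (R : realType) (alpha m G r y : R -> R)
    (K A dalpha dm t : R) :
  let v := alpha (y t) * r t - m (y t) in
  is_derive t 1 r (K - A * r t) -> is_derive t 1 y v ->
  is_derive (y t) 1 alpha dalpha -> is_derive (y t) 1 m dm ->
  is_derive (y t) 1 G (K - A * (m (y t) / alpha (y t))) ->
  0 < alpha (y t) -> alpha (y t) <= A -> dalpha <= 0 -> 0 <= dm ->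
  0 <= m (y t) -> 0 <= r t ->
  exists2 dE, is_derive t 1 (fun s =>
    (alpha (y s) * r s - m (y s)) ^+ 2 / (2 * alpha (y s)) - G (y s)) dE &
    dE <= - v ^+ 2.
Proof.
move=> v dr dy da dmm dG a0 aA da0 dm0 m0 r0.
have day := is_derive1_comp da dy.
have dmy := is_derive1_comp dmm dy.
have dGy := is_derive1_comp dG dy.
have dN := is_deriveB (is_deriveM day dr) dmy.
have d2a : is_derive t 1 (fun s => 2 * alpha (y s)) (2 * (dalpha * v)).
  exact: (@is_deriveZ _ _ _ (alpha \o y)).
have n2a : 2 * alpha (y t) != 0 by rewrite mulf_neq0// gt_eqF.
have dV := @is_deriveV R (fun s => 2 * alpha (y s)) t _ 1 n2a d2a.
have dE := is_deriveB (is_deriveM (is_deriveM dN dN) dV) dGy.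
move: dE; set D := (X in is_derive _ _ _ X) => dE; exists D.
  by apply: near_eq_is_derive dE; near=> s; rewrite !fctE /= expr2.
rewrite /D !fctE /= /GRing.scale /= -/v.
have [w hw] : exists w, w = v by eexists.
have [a ha] : exists a, a = alpha (y t) by eexists.
have [mm hm] : exists mm, mm = m (y t) by eexists.
rewrite -ha in a0 aA; rewrite -hm in m0; rewrite -hw -ha -hm.
have rE : r t = (w + mm) / a.
  by rewrite hw hm /v subrK -ha mulrC mulKf// gt_eqF.
set X := (X in X <= _).
(* Writing [A = a + (A - a)] isolates [- w ^+ 2]; the remaining terms have a sign by the
   hypotheses. *)
have -> : X = - w ^+ 2 - (w ^+ 2 / a * (A - a + dm) + w ^+ 2 / a * (- dalpha) * ((r t + mm / a) / 2)).
  by rewrite /X rE; field; rewrite gt_eqF.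
rewrite gerBl addr_ge0//.
  by rewrite mulr_ge0 ?divr_ge0 ?sqr_ge0 ?(ltW a0)// addr_ge0// subr_ge0.
rewrite mulr_ge0//; last by rewrite divr_ge0// addr_ge0// divr_ge0// ltW.
by rewrite mulr_ge0 ?oppr_ge0// divr_ge0 ?sqr_ge0// ltW.
Unshelve. all: by end_near. Qed.

Lemma service_min (R : realType) (mustar qc q : R) : 0 < mustar -> 0 < qc ->
  service mustar qc q = Num.min (mustar / qc * q) mustar.
Proof.
move=> m0 q0; rewrite /service mulrAC; have [qqc|qcq] := leP q qc.
  by rewrite min_l// ler_pdivrMr// ler_pM2l.
by rewrite min_r// ler_pdivlMr// ler_pM2l// ltW.
Qed.

Lemma service_lipschitz (R : realType) (mustar qc x y : R) :
  0 < mustar -> 0 < qc ->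
  `|service mustar qc x - service mustar qc y| <= mustar / qc * `|x - y|.
Proof.
move=> m0 q0; rewrite !service_min// (le_trans (min_lipschitz _ _ _))//.
by rewrite -mulrBr normrM ger0_norm// divr_ge0// ltW.
Qed.

Lemma service_gt0 (R : realType) (mustar qc q : R) :
  0 < mustar -> 0 < qc -> 0 < q -> 0 < service mustar qc q.
Proof. by move=> m0 qc0 q0; rewrite service_min// lt_min m0 mulr_gt0// divr_gt0. Qed.

(** At a maximum of [q] one has [alpha R = mu > 0], so [q] stays below [qmax] and [alpha] stays
    positive. The energy is nonincreasing and periodic, hence constant; so [q' = 0], and
    [R = mu / alpha] is constant as well. *)
Lemma no_periodic_solution (R : realType) (K mustar qc beta qm qmax : R)
    (f alpha : R -> R) :
  0 < mustar -> 0 < qc -> 0 < beta ->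
  (forall z, 0 <= z -> derivable f z 1) -> (forall z, 0 <= z -> 0 <= f z) ->
  (forall q, 0 <= q -> derivable alpha q 1) ->
  (forall q, 0 <= q -> q < qmax -> 0 < alpha q) ->
  (forall q, 0 < q -> q < qmax -> derive1 alpha q <= 0) ->
  (forall q, qmax <= q -> alpha q = 0) ->
  ~ exists x : R -> 'rV[R]_2,
      nontrivial_periodic_solution
        (vfield K f (price beta qm) alpha (service mustar qc)) x /\
      forall t, open_quadrant (x t).
Proof.
move=> m0 qc0 b0 df f0 da a0 da0 amax [x [[dx [T T0 xT] [t1 [t2 xt12]]] xpos]].
set p := price beta qm in dx; set mu := service mustar qc in dx.
pose r (t : R) : R := x t 0 0; pose y (t : R) : R := x t 0 1.
have r0 t : 0 < r t by have [] := xpos t.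
have y0 t : 0 < y t by have [] := xpos t.
pose A q := f (p q) + alpha q.
pose v (t : R) : R := alpha (y t) * r t - mu (y t).
have dr (t : R) : is_derive t 1 r (K - A (y t) * r t).
  have := (is_derive_mxP _ _ _ _).1 (dx t) 0 0; rewrite vec2E0.
  by rewrite /A mulrDl opprD addrA.
have dy (t : R) : is_derive t 1 y (v t).
  by have := (is_derive_mxP _ _ _ _).1 (dx t) 0 1; rewrite vec2E1.
have yT t : y (t + T) = y t by rewrite /y xT.
have rT t : r (t + T) = r t by rewrite /r xT.
have cy : {within `[0, T], continuous y}.
  by apply: continuous_subspaceT => t; exact: is_derive_continuous (dy t).
have mu0 t : 0 < mu (y t) by exact: service_gt0.
have [tM _ hM] := EVT_max (ltW T0) cy.
have [tm _ hm] := EVT_min (ltW T0) cy.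
have yM t : y t <= y tM.
  by have [u [u0 uT <-]] := periodic_reduce T0 yT t; apply: hM; rewrite in_itv/= u0.
have ym t : y tm <= y t.
  by have [u [u0 uT <-]] := periodic_reduce T0 yT t; apply: hm; rewrite in_itv/= u0.
have yMmax : y tM < qmax.
  (* By periodicity the maximum over [[0, T]] is global, so the interval around [tM] may reach
     beyond [[0, T]]. *)
  have [_ e] : is_derive tM 1 y 0.
    apply: (@derive1_at_max R y (tM - 1) (tM + 1) tM).
    - lra.
    - by move=> t _; case: (dy t).
    - by rewrite in_itv/=; apply/andP; split; lra.
    - by move=> t _.
  have vM : v tM = 0 by rewrite -e; case: (dy tM).
  rewrite ltNge; apply/negP => /amax aM; have := mu0 tM.
  by move: vM; rewrite /v aM mul0r sub0r => /eqP; rewrite oppr_eq0 => /eqP->; rewrite ltxx.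
have ymax t : y t < qmax by exact: le_lt_trans yMmax.
have ay t : 0 < alpha (y t) by apply: a0 => //; exact: ltW.
pose g q := K - A q * (mu q / alpha q).
(* Clamping to the range of [y] makes the integrand continuous on all of [R]. *)
pose clamp q := Num.min (Num.max q (y tm)) (y tM).
have clampP q : 0 < clamp q /\ clamp q < qmax.
  split; first by rewrite lt_min lt_max !y0 orbT.
  by rewrite gt_min yMmax orbT.
have clamp_id t : clamp (y t) = y t by rewrite /clamp max_l// min_l.
have cclamp : continuous clamp.
  apply: (@lipschitz_continuous _ _ _ _ 1) => // u w.
  by rewrite mul1r (le_trans (min_lipschitz _ _ _))// max_lipschitz.
have cmu : continuous mu.
  by apply: (@lipschitz_continuous _ _ _ _ (mustar / qc)) => [|u w]; [exact: divr_gt0|exact: service_lipschitz].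
have cal q : 0 < q -> {for q, continuous alpha}.
  by move=> /ltW/da daq; apply: differentiable_continuous; exact/derivable1_diffP.
have cf q : 0 < q -> {for q, continuous (f \o p)}.
  move=> q0; apply: continuous_comp; first exact: price_continuous.
  apply: differentiable_continuous; apply/derivable1_diffP/df.
  by apply: price_ge0 => //; exact: ltW.
have cg q : 0 < q -> q < qmax -> {for q, continuous g}.
  move=> q0 qm'; have aq := a0 q (ltW q0) qm'.
  apply: cvgB; first exact: cvg_cst.
  apply: cvgM; first by apply: cvgD; [exact: cf|exact: cal].
  by apply: cvgM; [exact: cmu|apply: cvgV; [rewrite gt_eqF|exact: cal]].
have cgc : continuous (g \o clamp).
  move=> q; apply: continuous_comp; first exact: cclamp.
  by have [? ?] := clampP q; exact: cg.
have [G dG] := continuous_primitive 0 cgc.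
have dGy (t : R) : is_derive (y t) 1 G (K - A (y t) * (mu (y t) / alpha (y t))).
  by have := dG (y t) (y0 t); rewrite /= clamp_id.
pose L (t : R) : R := (alpha (y t) * r t - mu (y t)) ^+ 2 / (2 * alpha (y t)) - G (y t).
have branch (m : R -> R) dm t : is_derive (y t) 1 m dm -> 0 <= dm -> m (y t) = mu (y t) ->
    exists2 dE, is_derive t 1 (fun s =>
    (alpha (y s) * r s - m (y s)) ^+ 2 / (2 * alpha (y s)) - G (y s)) dE &
    dE <= - v t ^+ 2.
  move=> dmm dm0 mt; rewrite /v -mt.
  have dal : is_derive (y t) 1 alpha (derive1 alpha (y t)).
    by apply: derivable_is_derive1; exact/da/ltW.
  apply: (energy_derivative_le (dr t) _ dal dmm) => //.
  - by rewrite mt; exact: dy.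
  - by rewrite mt; exact: dGy.
  - by rewrite lerDr f0// price_ge0// ltW.
  - exact: da0.
  - by rewrite mt ltW.
  - exact: ltW.
(* [L] is not differentiable when [y t = qc], but there both smooth branches of
   the service rate give the same bound. *)
have local t e : 0 < e -> \forall s \near t,
    (t < s -> L s - L t <= (- v t ^+ 2 + e) * (s - t)) /\
    (s < t -> L t - L s <= (- v t ^+ 2 + e) * (t - s)).
  move=> e0.
  have cyt : y s @[s --> t] --> y t by exact: is_derive_continuous (dy t).
  pose m1 q := mustar / qc * q.
  have step1 : y t <= qc -> \forall s \near t, y s <= qc ->
    (t < s -> L s - L t <= (- v t ^+ 2 + e) * (s - t)) /\
    (s < t -> L t - L s <= (- v t ^+ 2 + e) * (t - s)).
    move=> ytc; have mt : m1 (y t) = mu (y t) by rewrite /mu /service ytc.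
    have dm1 : is_derive (y t) 1 m1 (mustar / qc * 1) by exact: (@is_deriveZ _ _ _ id).
    have [|dE hE leE] := branch m1 _ t dm1 _ mt.
      by rewrite mulr1 divr_ge0// ltW.
    apply: filterS (is_derive_local_le hE leE e0) => s + ysc.
    by rewrite mt (_ : m1 (y s) = mu (y s))// /mu /service ysc.
  have step2 : qc <= y t -> \forall s \near t, qc <= y s ->
    (t < s -> L s - L t <= (- v t ^+ 2 + e) * (s - t)) /\
    (s < t -> L t - L s <= (- v t ^+ 2 + e) * (t - s)).
    have hmu q : qc <= q -> mustar = mu q.
      move=> cq; rewrite /mu service_min// min_r// mulrAC ler_pdivlMr// ler_pM2l//.
    move=> ytc; have mt := hmu _ ytc.
    have [dE hE leE] := branch (fun=> mustar) _ t (is_derive_cst mustar (y t) 1) (lexx 0) mt.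
    apply: filterS (is_derive_local_le hE leE e0) => s + ysc.
    by rewrite /L -(hmu _ ysc) -mt.
  case: (ltgtP (y t) qc) => [yc|yc|yc].
  - have h : \forall s \near t, y s <= qc.
      by near=> u; apply/ltW; near: u; exact: cvgr_lt cyt _ yc.
    by near=> s; apply: (near (step1 (ltW yc)) s) => //; near: s.
  - have h : \forall s \near t, qc <= y s.
      by near=> u; apply/ltW; near: u; exact: cvgr_gt cyt _ yc.
    by near=> s; apply: (near (step2 (ltW yc)) s) => //; near: s.
  - have h1 : y t <= qc by rewrite yc.
    have h2 : qc <= y t by rewrite yc.
    near=> s; case: (leP (y s) qc) => [|/ltW] ys.
      by apply: (near (step1 h1) s) => //; near: s.
    by apply: (near (step2 h2) s) => //; near: s.
have Lmono a b : a <= b -> L b <= L a.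
  apply: nonincreasing_local => t e e0.
  have v2 : - v t ^+ 2 + e <= e by rewrite gerDr oppr_le0 sqr_ge0.
  apply: filterS (local t e e0) => s [h1 h2]; split => st.
    by apply: (le_trans (h1 st)); rewrite ler_wpM2r// subr_ge0 ltW.
  by apply: (le_trans (h2 st)); rewrite ler_wpM2r// subr_ge0 ltW.
have LT t : L (t + T) = L t by rewrite /L yT rT.
have Lcst := periodic_nonincreasing_cst T0 LT Lmono.
have v0 t : v t = 0.
  apply/eqP/negPn/negP => vt.
  have v2 : 0 < v t ^+ 2 by rewrite lt_def sqr_ge0 sqrf_eq0 vt.
  (* With this value of [e] the local bound makes [L] drop strictly to the right of [t], although
     [L] is constant. *)
  have v22 : 0 < v t ^+ 2 / 2 by rewrite divr_gt0.
  have /nbhs_normP[d /= d0 hd] := local t _ v22.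
  have : `|t - (t + d / 2)| < d by rewrite opprD addrA subrr sub0r normrN gtr0_norm; lra.
  move=> /hd[h _]; have td : t < t + d / 2 by rewrite ltrDl divr_gt0.
  have := h td; rewrite (Lcst (t + d / 2) t) subrr.
  by have := mulr_gt0 v22 d0; lra.
have ycst : y t1 = y t2.
  by apply: is_derive_0_is_cst => t; have := dy t; rewrite v0.
have re t : r t = mu (y t) / alpha (y t).
  have /eqP := v0 t; rewrite /v subr_eq0 => /eqP <-.
  by rewrite mulrC mulKf// gt_eqF.
move/eqP: xt12; apply; apply: rV2_eqP => //.
by rewrite -/(r t1) -/(r t2) !re ycst.
Unshelve. all: by end_near. Qed.

(** * The Jacobian *)

Lemma vec2K (R : realType) (x : 'rV[R]_2) : vec2 (x 0 0) (x 0 1) = x.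
Proof. by apply: rV2_eqP; rewrite ?vec2E0 ?vec2E1. Qed.

Lemma mat2_eqP (R : realType) (a b c d : R) (M : 'M[R]_2) :
  M 0 0 = a -> M 0 1 = b -> M 1 0 = c -> M 1 1 = d -> M = mat2 a b c d.
Proof.
move=> <- <- <- <-; apply/matrixP => i j; rewrite mxE.
have I2 (k : 'I_2) : k = 0 \/ k = 1.
  by case: k => -[|[|//]] hk; [left|right]; exact: val_inj.
by have [->|->] := I2 i; have [->|->] := I2 j.
Qed.

Lemma vec2_shift0 (R : realType) (a b h : R) :
  h *: delta_mx 0 0 + vec2 a b = vec2 (h *: 1 + a) b.
Proof. by apply: rV2_eqP; rewrite !mxE /= ?mulr0 ?add0r. Qed.

Lemma vec2_shift1 (R : realType) (a b h : R) :
  h *: delta_mx 0 1 + vec2 a b = vec2 a (h *: 1 + b).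
Proof. by apply: rV2_eqP; rewrite !mxE /= ?mulr0 ?add0r. Qed.

Lemma derive_axis0 (R : realType) (W : normedModType R) (g : 'rV[R]_2 -> W)
    (a b : R) :
  'D_(delta_mx 0 0) g (vec2 a b) = 'D_1 (fun z => g (vec2 z b)) a.
Proof.
rewrite /derive.
have -> // : (fun h : R => h^-1 *: ((g \o shift (vec2 a b)) (h *: delta_mx 0 0) - g (vec2 a b))) =
    (fun h : R => h^-1 *: (((fun z => g (vec2 z b)) \o shift a) (h *: 1) - g (vec2 a b))).
by apply/funext => h /=; rewrite vec2_shift0.
Qed.

Lemma derive_axis1 (R : realType) (W : normedModType R) (g : 'rV[R]_2 -> W)
    (a b : R) :
  'D_(delta_mx 0 1) g (vec2 a b) = 'D_1 (fun z => g (vec2 a z)) b.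
Proof.
rewrite /derive.
have -> // : (fun h : R => h^-1 *: ((g \o shift (vec2 a b)) (h *: delta_mx 0 1) - g (vec2 a b))) =
    (fun h : R => h^-1 *: (((fun z => g (vec2 a z)) \o shift b) (h *: 1) - g (vec2 a b))).
by apply/funext => h /=; rewrite vec2_shift1.
Qed.

Lemma derivable_axis1 (R : realType) (W : normedModType R) (g : 'rV[R]_2 -> W)
    (a b : R) :
  derivable g (vec2 a b) (delta_mx 0 1) -> derivable (fun z => g (vec2 a z)) b 1.
Proof.
move=> dg; rewrite /derivable.
have -> : (fun h : R => h^-1 *: (((fun z => g (vec2 a z)) \o shift b) (h *: 1) - g (vec2 a b))) =
    (fun h : R => h^-1 *: ((g \o shift (vec2 a b)) (h *: delta_mx 0 1) - g (vec2 a b))).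
  by apply/funext => h /=; rewrite vec2_shift1.
exact: dg.
Qed.

Lemma DF_entry (R : realType) (F : 'rV[R]_2 -> 'rV[R]_2) (x : 'rV[R]_2) i j :
  differentiable F x -> DF F x i j = 'D_(delta_mx 0 j) (fun y => F y 0 i) x.
Proof.
move=> dF; have := deriveEjacobian (delta_mx 0 j) dF; rewrite -rowE.
rewrite derive_mx; last exact: diff_derivable.
by move/rowP/(_ i); rewrite !mxE.
Qed.

(** Differentiability of [F] is turned back into that of its ingredients: [mu] is [alpha * r] minus
    the second component, and [f \o p] comes from the first by dividing by [r]. For [r = 0] the
    entry carries the factor [r], whatever value [derive1 (f \o p)] takes. *)
Lemma vfield_jacobian (R : realType) (K : R) (f p alpha mu : R -> R) (r q : R) :
  derivable alpha q 1 -> differentiable (vfield K f p alpha mu) (vec2 r q) ->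
  DF (vfield K f p alpha mu) (vec2 r q) =
  mat2 (- (f (p q) + alpha q)) (- (r * (derive1 (f \o p) q + derive1 alpha q)))
       (alpha q) (r * derive1 alpha q - derive1 mu q).
Proof.
move=> da dF.
have dal : is_derive q 1 alpha (derive1 alpha q).
  exact: derivable_is_derive1.
have dFi i : derivable (fun z => vfield K f p alpha mu (vec2 r z) 0 i) q 1.
  apply: (@derivable_axis1 R R (fun x => vfield K f p alpha mu x 0 i)).
  by apply: (derivable_mxP _ _ _).1; exact: diff_derivable.
have e0 z : vfield K f p alpha mu (vec2 r z) 0 0 = K - f (p z) * r - alpha z * r.
  by rewrite vec2E0 vec2E0 vec2E1.
have e1 z : vfield K f p alpha mu (vec2 r z) 0 1 = alpha z * r - mu z.
  by rewrite vec2E1 vec2E0 vec2E1.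
have d0 := dFi 0; have d1 := dFi 1.
rewrite (funext e0) in d0; rewrite (funext e1) in d1.
have lin (k z : R) : is_derive z 1 (fun t : R => k * t) k.
  by rewrite -[X in is_derive _ _ _ X]mulr1; exact: (@is_deriveZ _ _ _ id).
have ar : is_derive q 1 (fun z => alpha z * r) (r * derive1 alpha q).
  rewrite (_ : (fun z => alpha z * r) = (fun z => r * alpha z)).
    exact: (@is_deriveZ _ _ _ alpha).
  by apply/funext => z; rewrite mulrC.
have E00 : 'D_1 (fun z => vfield K f p alpha mu (vec2 z q) 0 0) r = - (f (p q) + alpha q).
  have -> : (fun z => vfield K f p alpha mu (vec2 z q) 0 0) =
      (fun z => K - (f (p q) + alpha q) * z).
    by apply/funext => z; rewrite vec2E0 vec2E0 vec2E1 mulrDl opprD addrA.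
  have [_ ->] := is_deriveB (is_derive_cst K r 1) (lin (f (p q) + alpha q) r).
  by rewrite sub0r.
have E10 : 'D_1 (fun z => vfield K f p alpha mu (vec2 z q) 0 1) r = alpha q.
  have -> : (fun z => vfield K f p alpha mu (vec2 z q) 0 1) =
      (fun z => alpha q * z - mu q).
    by apply/funext => z; rewrite vec2E1 vec2E0 vec2E1.
  have [_ ->] := is_deriveB (lin (alpha q) r) (is_derive_cst (mu q) r 1).
  by rewrite subr0.
have E01 : 'D_1 (fun z => vfield K f p alpha mu (vec2 r z) 0 0) q =
    - (r * (derive1 (f \o p) q + derive1 alpha q)).
  rewrite (funext e0).
  have [r0|r0] := eqVneq r 0.
    rewrite r0 mul0r oppr0 (_ : (fun z => _) = (fun=> K)) ?derive_cst//.
    by apply/funext => z; rewrite !mulr0 !subr0.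
  have dfp : derivable (f \o p) q 1.
    have -> : f \o p = (fun z => r^-1 * (K - (K - f (p z) * r - alpha z * r) - alpha z * r)).
      by apply/funext => z /=; field.
    apply: (@derivableZ _ _ _ (fun z => K - (K - f (p z) * r - alpha z * r) - alpha z * r)).
    apply: derivableB; last by case: ar.
    by apply: derivableB d0; exact: derivable_cst.
  have dfpr : is_derive q 1 (fun z => f (p z) * r) (r * derive1 (f \o p) q).
    rewrite (_ : (fun z => f (p z) * r) = (fun z => r * (f \o p) z)).
      apply: (@is_deriveZ _ _ _ (f \o p)).
      exact: derivable_is_derive1.
    by apply/funext => z; rewrite mulrC.
  have [_ ->] := is_deriveB (is_deriveB (is_derive_cst K q 1) dfpr) ar.
  by rewrite sub0r mulrDr opprD.
have E11 : 'D_1 (fun z => vfield K f p alpha mu (vec2 r z) 0 1) q =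
    r * derive1 alpha q - derive1 mu q.
  rewrite (funext e1).
  have dmu : is_derive q 1 mu (derive1 mu q).
    apply: derivable_is_derive1.
    have -> : mu = (fun z => alpha z * r - (alpha z * r - mu z)).
      by apply/funext => z; rewrite opprB addrC subrK.
    by apply: derivableB d1; case: ar.
  by have [_ ->] := is_deriveB ar dmu.
by apply: mat2_eqP; rewrite DF_entry// ?derive_axis0 ?derive_axis1.
Qed.

(** * Continuous differentiability near a point *)

Definition C1_near (R : realType) (g : R -> R) (q0 : R) : Prop :=
  (\forall q \near q0, derivable g q 1) /\
  derive1 g q @[q --> q0] --> derive1 g q0.

Lemma C1_near_eq (R : realType) (g h : R -> R) (q0 : R) :
  (\forall q \near q0, g q = h q) -> C1_near g q0 -> C1_near h q0.
Proof.
move=> gh [dg cg]; have gh2 := near_join gh; split.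
  near=> q; apply: (@near_eq_derivable _ _ _ g); last by near: q.
  by near: q.
have e : \forall q \near q0, derive1 g q = derive1 h q.
  by near=> q; rewrite !derive1E; apply: near_eq_derive; near: q.
rewrite -(nbhs_singleton e); apply: cvg_trans cg; apply: near_eq_cvg.
by apply: filterS e => q ->.
Unshelve. all: by end_near. Qed.

Lemma C1_nonneg_near (R : realType) (g : R -> R) (q0 : R) :
  0 < q0 -> C1_nonneg g -> C1_near g q0.
Proof.
move=> q00 [dg cg]; split.
  by near=> q; apply: dg; apply: ltW; near: q; exact: lt_nbhsr.
have /continuous_within_itvcyP [cg' _] := cg.
by apply: cg'; rewrite in_itv/= q00.
Unshelve. all: by end_near. Qed.

(** Near each fixed point the price is affine, which reduces [f \o p] to this case. *)
Lemma C1_near_comp_affine (R : realType) (g : R -> R) (a b q0 : R) :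
  C1_near g (a * q0 + b) -> C1_near (fun q => g (a * q + b)) q0.
Proof.
move=> [dg cg].
have dl (q : R) : is_derive q 1 (fun q => a * q + b) a.
  rewrite -[X in is_derive _ _ _ X]addr0; apply: is_deriveD.
  by rewrite -[X in is_derive _ _ _ X]mulr1; exact: (@is_deriveZ _ _ _ id).
have cl : a * q + b @[q --> q0] --> a * q0 + b.
  exact: is_derive_continuous (dl q0).
have ndg : \forall q \near q0, derivable g (a * q + b) 1.
  by apply: (cl (fun z => derivable g z 1)); exact: dg.
have dc (q : R) : derivable g (a * q + b) 1 ->
    is_derive q 1 (fun q => g (a * q + b)) (derive1 g (a * q + b) * a).
  move=> dgq; have h : is_derive (a * q + b) 1 g (derive1 g (a * q + b)).
    exact: derivable_is_derive1.
  by have := @is_derive1_comp R g (fun q => a * q + b) q _ _ h (dl q); apply.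
have e : \forall q \near q0,
    derive1 g (a * q + b) * a = derive1 (fun q => g (a * q + b)) q.
  near=> q; rewrite [RHS]derive1E; have ndq : derivable g (a * q + b) 1 by near: q.
  by have [_ ->] := dc q ndq.
split.
  near=> q; have ndq : derivable g (a * q + b) 1 by near: q.
  by have [] := dc q ndq.
rewrite -(nbhs_singleton e).
have h : derive1 g (a * q + b) * a @[q --> q0] --> derive1 g (a * q0 + b) * a.
  apply: cvgM; last exact: cvg_cst.
  by apply: (@continuous_cvg _ _ _ _ _ (fun q => a * q + b) (derive1 g)) cl; exact: cg.
apply: cvg_trans h; apply: near_eq_cvg.
by apply: filterS e => q ->.
Unshelve. all: by end_near. Qed.

Lemma C1_near_cst (R : realType) (k q0 : R) : C1_near (fun=> k) q0.
Proof.
split; first by near=> q; exact: derivable_cst.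
rewrite derive1_cst.
under eq_fun do rewrite derive1_cst.
exact: cvg_cst.
Unshelve. all: by end_near. Qed.

Lemma C1_near_is_derive (R : realType) (g : R -> R) (q0 : R) :
  C1_near g q0 -> is_derive q0 1 g (derive1 g q0).
Proof.
by move=> [/nbhs_singleton dg _]; exact: derivable_is_derive1.
Qed.

Lemma vfield_differentiable (R : realType) (K : R) (f p alpha mu : R -> R)
    (x : 'rV[R]_2) :
  derivable (f \o p) (x 0 1) 1 -> derivable alpha (x 0 1) 1 ->
  derivable mu (x 0 1) 1 -> differentiable (vfield K f p alpha mu) x.
Proof.
move=> /derivable1_diffP df /derivable1_diffP da /derivable1_diffP dm.
have c0 := @differentiable_coord R 1 2 x 0 0.
have c1 := @differentiable_coord R 1 2 x 0 1.
have dfx := differentiable_comp c1 df.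
have dax := differentiable_comp c1 da.
have dmx := differentiable_comp c1 dm.
have -> : vfield K f p alpha mu = fun y : 'rV[R]_2 =>
    (K - f (p (y 0 1)) * y 0 0 - alpha (y 0 1) * y 0 0) *: delta_mx 0 0 +
    (alpha (y 0 1) * y 0 0 - mu (y 0 1)) *: delta_mx 0 1.
  by apply/funext => y; apply: rV2_eqP; rewrite !mxE /= ?mulr0 ?mulr1 ?addr0 ?add0r.
apply: differentiableD; apply: differentiableZl.
  apply: differentiableB; last exact: differentiableM.
  apply: differentiableB; first exact: differentiable_cst.
  exact: differentiableM.
by apply: differentiableB => //; exact: differentiableM.
Qed.

Lemma vfield_C1 (R : realType) (K : R) (f p alpha mu : R -> R) (r0 q0 : R) :
  C1_near (f \o p) q0 -> C1_near alpha q0 -> C1_near mu q0 ->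
  C1_at (vfield K f p alpha mu) (vec2 r0 q0).
Proof.
move=> [df cf] [da ca] [dm cm].
set F := vfield _ _ _ _ _; set c := vec2 r0 q0.
have c0 : (y : 'rV[R]_2) 0 0 @[y --> c] --> r0.
  by have := @coord_continuous R 1 2 0 0 c; rewrite /continuous_at vec2E0.
have c1 : (y : 'rV[R]_2) 0 1 @[y --> c] --> q0.
  by have := @coord_continuous R 1 2 0 1 c; rewrite /continuous_at vec2E1.
have ndf : \forall y \near c, derivable (f \o p) ((y : 'rV[R]_2) 0 1) 1 by exact: c1 _ df.
have nda : \forall y \near c, derivable alpha ((y : 'rV[R]_2) 0 1) 1 by exact: c1 _ da.
have ndm : \forall y \near c, derivable mu ((y : 'rV[R]_2) 0 1) 1 by exact: c1 _ dm.
have ndF : \forall y \near c, differentiable F y.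
  by apply: filterS3 ndf nda ndm => y h1 h2 h3; exact: vfield_differentiable.
split; first exact: ndF.
pose J (y : 'rV[R]_2) := mat2 (- (f (p (y 0 1)) + alpha (y 0 1)))
  (- (y 0 0 * (derive1 (f \o p) (y 0 1) + derive1 alpha (y 0 1))))
  (alpha (y 0 1)) (y 0 0 * derive1 alpha (y 0 1) - derive1 mu (y 0 1)).
have eJ : \forall y \near c, J y = DF F y.
  apply: filterS2 nda ndF => y day dFy.
  have := @vfield_jacobian R K f p alpha mu (y 0 0) (y 0 1) day.
  by rewrite vec2K => /(_ dFy) ->.
have cont (g : R -> R) : {for q0, continuous g} ->
    g ((y : 'rV[R]_2) 0 1) @[y --> c] --> g q0.
  by move=> cg; apply: (@continuous_cvg _ _ _ _ _ (fun y : 'rV[R]_2 => y 0 1) g) c1; exact: cg.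
have dcont (g : R -> R) : (\forall q \near q0, derivable g q 1) -> {for q0, continuous g}.
  by move=> /nbhs_singleton dg; apply: differentiable_continuous; exact/derivable1_diffP.
have cfp := cont _ (dcont _ df); have cal := cont _ (dcont _ da).
have cdf := cont _ cf; have cda := cont _ ca; have cdm := cont _ cm.
suff cJ : J y @[y --> c] --> J c.
  rewrite /prop_for /continuous_at -(nbhs_singleton eJ).
  exact: (cvg_trans (near_eq_cvg eJ) cJ).
have I2 (k : 'I_2) : k = 0 \/ k = 1.
  by case: k => -[|[|//]] hk; [left|right]; exact: val_inj.
apply: (@cvg_mx R _ _ 2 2 J _ (nbhs_filter c)) => i j.
have -> : J c i j = mat2 (- (f (p q0) + alpha q0))
  (- (r0 * (derive1 (f \o p) q0 + derive1 alpha q0)))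
  (alpha q0) (r0 * derive1 alpha q0 - derive1 mu q0) i j.
  by rewrite /J /c vec2E0 vec2E1.
rewrite mxE; under eq_fun do rewrite mxE.
have [->|->] := I2 i; have [->|->] := I2 j => /=.
- by apply: cvgN; exact: cvgD.
- by apply: cvgN; apply: cvgM; [exact: c0|exact: cvgD].
- exact: cal.
- by apply: cvgB; [exact: cvgM|exact: cdm].
Unshelve. all: by end_near. Qed.

Lemma vfield_lipschitz_at (R : realType) (K : R) (f p alpha mu : R -> R)
    (r0 q0 : R) :
  lipschitz_at (f \o p) q0 -> lipschitz_at alpha q0 -> lipschitz_at mu q0 ->
  lipschitz_at (vfield K f p alpha mu) (vec2 r0 q0).
Proof.
move=> lf la lm.
have c0 := lipschitz_at_coord 0 0 (vec2 r0 q0).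
have c1 := lipschitz_at_coord 0 1 (vec2 r0 q0).
have l (g : R -> R) : lipschitz_at g q0 ->
    lipschitz_at (fun y : 'rV[R]_2 => g (y 0 1)) (vec2 r0 q0).
  by move=> lg; apply: (lipschitz_at_comp c1); rewrite vec2E1.
apply: lipschitz_at_vec2; apply: lipschitz_atB.
- by apply: lipschitz_atB; [exact: lipschitz_at_cst|apply: lipschitz_atM => //; exact: (l _ lf)].
- by apply: lipschitz_atM => //; exact: (l _ la).
- by apply: lipschitz_atM => //; exact: (l _ la).
- exact: (l _ lm).
Qed.

(** A negative determinant makes the discriminant exceed [(a + d) ^+ 2], so the roots have opposite
    signs. [eigenvalue] refers to row vectors, and [(c, l - a)] is a left eigenvector, nonzero as
    [c != 0]. *)
Lemma mat2_saddle_eigenvalues (R : realType) (a b c d : R) :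
  c != 0 -> a * d - b * c < 0 ->
  exists l1 l2, [/\ l1 < 0, 0 < l2,
    eigenvalue (mat2 a b c d) l1 & eigenvalue (mat2 a b c d) l2].
Proof.
move=> c0 det; pose D := (a + d) ^+ 2 - 4 * (a * d - b * c).
have eig l : l ^+ 2 - (a + d) * l + (a * d - b * c) = 0 ->
    eigenvalue (mat2 a b c d) l.
  move=> hl; apply/eigenvalueP; exists (vec2 c (l - a)).
    apply: rV2_eqP; rewrite !mxE !big_ord_recl big_ord0 addr0 !mxE /=; first by ring.
    by move: hl; lra.
  by apply: contraNneq c0 => /rowP/(_ 0); rewrite !mxE /= => ->.
have D0 : (a + d) ^+ 2 < D by rewrite /D; lra.
have S2 : Num.sqrt D ^+ 2 = D by rewrite sqr_sqrtr// ltW// (le_lt_trans _ D0)// sqr_ge0.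
have S0 : `|a + d| < Num.sqrt D.
  by rewrite -(ltr_pXn2r (ltn0Sn 1)) ?nnegrE// S2 real_normK ?num_real.
move: S0; rewrite ltr_norml => /andP[S1 S3].
exists (((a + d) - Num.sqrt D) / 2), (((a + d) + Num.sqrt D) / 2); split.
- lra.
- lra.
- by apply: eig; move: S2; rewrite /D; set S := Num.sqrt _ => S2; field: S2.
- by apply: eig; move: S2; rewrite /D; set S := Num.sqrt _ => S2; field: S2.
Qed.

(** * Proof of the theorem *)

Lemma C1_near_lipschitz (R : realType) (g : R -> R) (q0 : R) :
  C1_near g q0 -> lipschitz_at g q0.
Proof. by move=> [dg cg]; exact: lipschitz_at_C1. Qed.

Lemma service_plateau (R : realType) (mustar qc q : R) :
  qc < q -> \forall z \near q, mustar = service mustar qc z.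
Proof.
move=> qcq; near=> z; rewrite /service ifF//; apply/negbTE; rewrite -ltNge.
by near: z; exact: lt_nbhsr.
Unshelve. all: by end_near. Qed.

Lemma service_eq_mustar (R : realType) (mustar qc q : R) :
  0 < mustar -> 0 < qc -> service mustar qc q = mustar -> qc <= q.
Proof.
move=> m0 qc0; rewrite leNgt => h; apply/negP => qqc.
move: h; rewrite /service (ltW qqc) => /eqP; apply/negP; rewrite lt_eqF//.
by rewrite mulrAC ltr_pdivrMr// ltr_pM2l.
Qed.

(** Supplies the slope [j] of the stability argument. A chord from a plateau point, possibly [qc]
    itself, to a point below [qc] has slope [mustar / qc] times the fraction of its base lying below
    [qc]. *)
Lemma service_slope (R : realType) (mustar qc q0 q : R) :
  0 < mustar -> 0 < qc -> qc <= q0 ->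
  exists j, [/\ 0 <= j, j <= mustar / qc &
    service mustar qc q - service mustar qc q0 = j * (q - q0)].
Proof.
move=> m0 qc0 cq0; have hm z : qc <= z -> service mustar qc z = mustar.
  by move=> cz; rewrite service_min// min_r// mulrAC ler_pdivlMr// ler_pM2l.
have mq0 : 0 <= mustar / qc by rewrite divr_ge0// ltW.
rewrite (hm _ cq0); have [cq|qqc] := leP qc q.
  by exists 0; rewrite hm// mul0r subrr.
have d0 : 0 < q0 - q by rewrite subr_gt0; exact: lt_le_trans cq0.
exists (mustar / qc * ((qc - q) / (q0 - q))); split.
- by apply: mulr_ge0 => //; apply: divr_ge0; [rewrite subr_ge0 ltW|exact: ltW].
- by rewrite ler_piMr// ler_pdivrMr// mul1r lerD2r.
- have d1 : q0 - q != 0 by rewrite gt_eqF.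
  have c1 : qc != 0 by rewrite gt_eqF.
  by rewrite /service (ltW qqc); field; rewrite d1 c1.
Qed.

(** The [+ 0] keeps the shape [a * q + b] of the affine chain rule. *)
Lemma price_rising (R : realType) (beta qm q : R) :
  q < qm -> \forall z \near q, beta * z + 0 = price beta qm z.
Proof.
move=> qqm; near=> z; rewrite /price ifT ?addr0//.
by apply: ltW; near: z; exact: lt_nbhsl.
Unshelve. all: by end_near. Qed.

Lemma price_falling (R : realType) (beta qm q : R) :
  qm < q -> q < 2 * qm ->
  \forall z \near q, - beta * z + beta * (2 * qm) = price beta qm z.
Proof.
move=> qmq q2; near=> z; rewrite /price ifF.
  rewrite ifT; last by apply: ltW; near: z; exact: lt_nbhsl.
  ring.
apply/negbTE; rewrite -ltNge; near: z; exact: lt_nbhsr.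
Unshelve. all: by end_near. Qed.

(** [C1_at F xs] is claimed for [qs != qc] only: at [qs = qc] the service rate has one-sided slopes
    [mustar / qc] and 0. Stability of [xs] is asserted in both cases. *)
Theorem lemma3p3 (R : realType) (K mustar qc beta qm qmax : R)
    (f alpha : R -> R) (qs qu : R) :
  let p := price beta qm in
  let mu := service mustar qc in
  let eta1 := fun q : R => mu q / alpha q in
  let eta2 := fun q : R => K / (alpha q + f (p q)) in
  let F := vfield K f p alpha mu in
  let xs := vec2 (eta1 qs) qs in
  let xu := vec2 (eta1 qu) qu in
  0 < K -> 0 < mustar -> 0 < qc -> 0 < beta -> 0 < qm -> 0 < qmax ->
  mustar < K -> 2 * qm <= qmax ->
  C1_nonneg f ->
  (forall z, 0 <= z -> 0 <= f z) ->
  (forall z, 0 <= z -> 0 < derive1 f z) ->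
  C1_nonneg alpha ->
  (forall q, 0 <= q -> 0 <= alpha q) ->
  (forall q, 0 <= q -> q < qmax -> 0 < alpha q) ->
  (forall q1 q2, 0 <= q1 -> q1 < q2 -> q2 < qmax -> alpha q2 < alpha q1) ->
  (forall q, qmax <= q -> alpha q = 0) ->
  (forall q, 0 < q -> q < qmax -> (eta1 q = eta2 q <-> q = qs \/ q = qu)) ->
  0 < qs -> qs < qm -> qm < qu -> qu < 2 * qm ->
  derive1 eta1 qu < derive1 eta2 qu ->
  mu qs = mustar -> mu qu = mustar ->
  [/\ (qs != qc -> C1_at F xs) /\ C1_at F xu,
      forall r q : R, 0 <= r -> 0 <= q -> differentiable F (vec2 r q) ->
        DF F (vec2 r q) =
        mat2 (- (f (p q) + alpha q))
             (- (r * (derive1 (f \o p) q + derive1 alpha q)))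
             (alpha q)
             (r * derive1 alpha q - derive1 mu q),
      forall r q : R, 0 <= r -> differentiable F (vec2 r q) ->
        (0 < q -> q < qc ->
           divergence F (vec2 r q) =
           - f (p q) - alpha q + derive1 alpha q * r - mustar / qc) /\
        (qc < q ->
           divergence F (vec2 r q) =
           - f (p q) - alpha q + derive1 alpha q * r) &
   [/\ locally_asymptotically_stable F xs,
       unstable F xu /\
       (exists l1 l2 : R, [/\ l1 < 0, 0 < l2,
          eigenvalue (DF F xu) l1 & eigenvalue (DF F xu) l2]) &
       ~ exists x : R -> 'rV[R]_2,
           nontrivial_periodic_solution F x /\
           forall t, open_quadrant (x t)]].
Proof.
move=> p mu eta1 eta2 F xs xu K0 m0 qc0 b0 qm0 qmax0 mK qm2 C1f f0 df0 C1a a0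
  apos adec amax heq qs0 qsm qum qu2 deta mus muu.
have qu0 : 0 < qu by exact: lt_trans qum.
have qsmax : qs < qmax by lra.
have qumax : qu < qmax by lra.
have as0 : 0 < alpha qs by apply: apos => //; exact: ltW.
have au0 : 0 < alpha qu by apply: apos => //; exact: ltW.
have fs0 : 0 <= f (p qs) by apply: f0; apply: price_ge0 => //; exact: ltW.
have fu0 : 0 <= f (p qu) by apply: f0; apply: price_ge0 => //; exact: ltW.
have da0 q : 0 < q -> q < qmax -> derive1 alpha q <= 0.
  move=> q0 qqmax; apply: (@decr_derive1_le0_itv R alpha false true 0 qmax q).
  - by move=> z; rewrite inE/= in_itv/= => /andP[z0 _]; apply: C1a.1; exact: ltW.
  - move=> z w; rewrite !in_itv/= => /andP[z0 zm] /andP[w0 wm] zw.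
    by apply: adec => //; exact: ltW.
  - by rewrite in_itv/= q0.
have cqs : qc <= qs by exact: service_eq_mustar mus.
(* The kink of the service rate can thus coincide with [qs] but not with [qu]. *)
have cqu : qc < qu by lra.
(* [eta1 q = eta2 q] says that the nullclines [R = mu / alpha] and [R = K / (alpha + f)] meet. *)
have equil q : 0 < q -> q < qmax -> 0 < alpha q -> 0 <= f (p q) -> mu q = mustar ->
    eta1 q = eta2 q -> [/\ 0 < eta1 q, alpha q * eta1 q = mu q &
      (f (p q) + alpha q) * eta1 q = K].
  move=> q0 qqmax aq fq muq e; split.
  - by rewrite /eta1 muq divr_gt0.
  - by rewrite /eta1 mulrC divfK// gt_eqF.
  - by rewrite e /eta2 [f _ + _]addrC mulrC divfK// gt_eqF// ltr_pwDl.
have [Rs0 aRs fRs] := equil qs qs0 qsmax as0 fs0 mus ((heq qs qs0 qsmax).2 (or_introl erefl)).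
have [Ru0 aRu fRu] := equil qu qu0 qumax au0 fu0 muu ((heq qu qu0 qumax).2 (or_intror erefl)).
have Cas := C1_nonneg_near qs0 C1a; have Cau := C1_nonneg_near qu0 C1a.
have Cfs : C1_near (f \o p) qs.
  apply: (@C1_near_eq R (fun q => f (beta * q + 0))).
    by near=> q; congr f; near: q; exact: price_rising.
  by apply: C1_near_comp_affine; apply: C1_nonneg_near => //; rewrite addr0 mulr_gt0.
have Cfu : C1_near (f \o p) qu.
  apply: (@C1_near_eq R (fun q => f (- beta * q + beta * (2 * qm)))).
    by near=> q; congr f; near: q; exact: price_falling.
  apply: C1_near_comp_affine; apply: C1_nonneg_near => //.
  by rewrite mulNr addrC -mulrBr mulr_gt0// subr_gt0.
have Cm q : qc < q -> C1_near mu q.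
  by move=> cq; apply: C1_near_eq (C1_near_cst mustar q); exact: service_plateau.
have dmu q : qc < q -> is_derive q 1 mu 0.
  move=> cq; apply: (@near_eq_is_derive _ _ _ (fun=> mustar)) => //.
  exact: service_plateau.
have lmu q : lipschitz_at mu q.
  exists (mustar / qc), 1; split => //; first exact: divr_gt0.
  by move=> x y _ _; exact: service_lipschitz.
have dfs := C1_near_is_derive Cfs; have dfu := C1_near_is_derive Cfu.
have das := C1_near_is_derive Cas; have dau := C1_near_is_derive Cau.
(* [qs] lies on the rising branch of the price, where [p] has slope [beta]. *)
have dphis : 0 < derive1 (f \o p) qs.
  have bqs0 : 0 <= beta * qs + 0 by rewrite addr0 mulr_ge0// ltW.
  have hf : is_derive (beta * qs + 0) 1 f (derive1 f (beta * qs + 0)).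
    by apply: derivable_is_derive1; exact: C1f.1.
  have hl : is_derive qs 1 (fun q => beta * q + 0) beta.
    rewrite -[X in is_derive _ _ _ X]addr0; apply: is_deriveD.
    by rewrite -[X in is_derive _ _ _ X]mulr1; exact: (@is_deriveZ _ _ _ id).
  have h := @is_derive1_comp R f (fun q => beta * q + 0) qs _ _ hf hl.
  have [_ e] : is_derive qs 1 (f \o p) (derive1 f (beta * qs + 0) * beta).
    apply: near_eq_is_derive h; near=> q => /=; congr f; near: q.
    exact: price_rising.
  by rewrite derive1E e mulr_gt0// df0.
have dets : f (p qs) * derive1 alpha qs < alpha qs * derive1 (f \o p) qs.
  by rewrite (le_lt_trans _ (mulr_gt0 as0 dphis))// mulr_ge0_le0// da0.
(* As [mu] is locally constant at [qu], [eta1' = - R alpha' / alpha] and [eta2' = - R (alpha' + (f o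
   p)') / (alpha + f)]; clearing denominators in [eta1' < eta2'] gives this inequality. *)
have detu : alpha qu * derive1 (f \o p) qu < f (p qu) * derive1 alpha qu.
  have au1 : alpha qu != 0 by rewrite gt_eqF.
  have af0 : 0 < alpha qu + f (p qu) by rewrite ltr_pwDl.
  have af1 : alpha qu + f (p qu) != 0 by rewrite gt_eqF.
  have [_ e1] := is_deriveM (dmu qu cqu) (is_deriveV au1 dau).
  have daf : is_derive qu 1 (fun q => alpha q + f (p q))
    (derive1 alpha qu + derive1 (f \o p) qu) by exact: is_deriveD.
  have [_ e2] := is_deriveZ K (@is_deriveV R (fun q => alpha q + f (p q)) qu _ 1 af1 daf).
  move: deta; rewrite !derive1E [X in X < _ -> _]e1 [X in _ < X -> _]e2.
  rewrite -!derive1E /GRing.scale /= mulr0 addr0.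
  rewrite -aRu -fRu [f (p qu) + _]addrC.
  set a := alpha qu in af0 af1 au0 au1 *; set b := f (p qu) in af0 af1 *.
  set da := derive1 alpha qu; set db := derive1 (f \o p) qu; set r := eta1 qu in Ru0 *.
  have -> : a * r * (- a ^- 2 * da) = - (r * da / a) by field.
  have -> : (a + b) * r * (- (a + b) ^- 2 * (da + db)) = - (r * (da + db) / (a + b)).
    by field.
  rewrite ltrN2 ltr_pdivrMr// [ltRHS]mulrAC ltr_pdivlMr// => h.
  have : 0 < r * (b * da - a * db) by lra.
  by rewrite pmulr_rgt0// subr_gt0.
have lxs : lipschitz_at F xs.
  by apply: vfield_lipschitz_at => //; exact: C1_near_lipschitz.
have lxu : lipschitz_at F xu.
  by apply: vfield_lipschitz_at => //; exact: C1_near_lipschitz.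
have jac r q : 0 <= q -> differentiable F (vec2 r q) ->
  DF F (vec2 r q) = mat2 (- (f (p q) + alpha q))
    (- (r * (derive1 (f \o p) q + derive1 alpha q)))
    (alpha q) (r * derive1 alpha q - derive1 mu q).
  by move=> q0 dF; apply: vfield_jacobian => //; exact: C1a.1.
have C1u : C1_at F xu by exact: vfield_C1 Cfu Cau (Cm qu cqu).
split.
- split; last exact: C1u.
  move=> qsc; apply: vfield_C1 Cfs Cas _; apply: Cm.
  by rewrite lt_def qsc.
- by move=> r q _; exact: jac.
- move=> r q r0 dF.
  have div q1 : 0 < q -> derive1 mu q = q1 ->
      divergence F (vec2 r q) = - f (p q) - alpha q + derive1 alpha q * r - q1.
    (* The divergence is the trace of the Jacobian. *)
    move=> q0 <-; rewrite /divergence big_ord_recl big_ord_recl big_ord0 addr0.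
    rewrite -!DF_entry// jac// ?ltW// !mxE /=; ring.
  split => [q0 qqc|qcq].
    apply: div => //; rewrite derive1E.
    have h : is_derive q 1 (fun z => mustar / qc * z) (mustar / qc).
      by rewrite -[X in is_derive _ _ _ X]mulr1; exact: (@is_deriveZ _ _ _ id).
    have [_ //] : is_derive q 1 mu (mustar / qc).
    apply: near_eq_is_derive h; near=> z; rewrite /mu /service ifT//.
    by apply: ltW; near: z; exact: lt_nbhsl.
  rewrite (div 0) ?subr0//; first exact: lt_trans qcq.
  by rewrite derive1E; have [_ ->] := dmu q qcq.
- split.
  (* The bound [mustar / qc] on the chord slopes includes the case [qs = qc]. *)
  + apply: (@vfield_stable R K f p alpha mu _ qs _ _ (mustar / qc) dfs das) => //; [exact: da0|by rewrite divr_ge0// ltW|].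
    by move=> q; exact: service_slope.
  + split.
      apply: (vfield_saddle dfu dau) => //; first exact: da0.
      near=> q; rewrite muu; apply/esym; near: q; exact: service_plateau.
    have dFu : differentiable F xu by exact: nbhs_singleton C1u.1.
    rewrite jac//; last exact: ltW.
    apply: mat2_saddle_eigenvalues; first by rewrite gt_eqF.
    have [_ e] := dmu qu cqu; rewrite [derive1 mu qu]derive1E e.
    (* This product is minus the determinant of the Jacobian at [xu]. *)
    have : 0 < eta1 qu * (f (p qu) * derive1 alpha qu - alpha qu * derive1 (f \o p) qu).
      by rewrite mulr_gt0// subr_gt0.
    lra.
  + apply: (@no_periodic_solution R K mustar qc beta qm qmax) => //.
    exact: C1f.1.
    exact: C1a.1.
Unshelve. all: by end_near. Qed.
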